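(* Let $q=4$. Under $G_4$ there are exactly $12$ line orbits, namely: the sets of RC-lines ($10$), RA-lines ($10$), Un$\Gamma$-lines ($60$) and E$\Gamma$-lines ($60$); the $G_4^*$-orbit of U$\Gamma$-lines of size $15$; the union of the Tr-lines with the $G_4^*$-orbit of U$\Gamma$-lines of size $5$ (total $10$); the union of the IC-lines and the IA-lines (total $12$); and, for the En$\Gamma$-lines: exactly one of the three $G_4^*$-orbits of size $20$ is a $G_4$-orbit, while the other two merge into one $G_4$-orbit of size $40$; exactly two of the four $G_4^*$-orbits of size $30$ are $G_4$-orbits, while the other two merge into one $G_4$-orbit of size $60$. In particular, with $\xi$ a primitive element of $\mathbb F_4$, the lines $\{x_2=0,\ x_0=\xi x_3\}$ and $\{x_1=0,\ x_0=\xi x_3\}$ are En$\Gamma$-lines lying in the two distinct $G_4^*$-orbits of size $20$ that merge.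
   Context: Notation. $\mathbb F_q$ is the field with $q$ elements, $\mathbb F_q^+=\mathbb F_q\cup\{\infty\}$. Points of $\mathrm{PG}(3,q)$ are written $\mathbf P(x_0,x_1,x_2,x_3)$ with $x$ a nonzero row vector up to scalars; $\boldsymbol\pi(c_0,c_1,c_2,c_3)$ is the plane $c_0x_0+c_1x_1+c_2x_2+c_3x_3=0$. Put $P(t)=\mathbf P(t^3,t^2,t,1)$ for $t\in\mathbb F_q$, $P(\infty)=\mathbf P(1,0,0,0)$, and $\mathscr C=\{P(t):t\in\mathbb F_q^+\}$ (the twisted cubic). The osculating planes are $\pi_{\rm osc}(t)=\boldsymbol\pi(1,-3t,3t^2,-t^3)$ ($t\in\mathbb F_q$) and $\pi_{\rm osc}(\infty)=\boldsymbol\pi(0,0,0,1)$; these $q+1$ planes are called $\Gamma$-planes. The tangent at $P(t)$, $t\in\mathbb F_q$, is the line through $P(t)$ and $\mathbf P(3t^2,2t,1,0)$; the tangent at $P(\infty)$ is the line through $\mathbf P(1,0,0,0)$ and $\mathbf P(0,1,0,0)$. A real chord is a line through two distinct points of $\mathscr C$; a real axis is the intersection of two distinct $\Gamma$-planes. For $\alpha\in\mathbb F_{q^2}\setminus\mathbb F_q$, the line of $\mathrm{PG}(3,q^2)$ through $P(\alpha),P(\alpha^q)$ (resp. the intersection of the planes $\pi_{\rm osc}(\alpha),\pi_{\rm osc}(\alpha^q)$, given by the same formulas over $\mathbb F_{q^2}$) is defined over $\mathbb F_q$, and the corresponding line of $\mathrm{PG}(3,q)$ is an imaginary chord (resp.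 imaginary axis). A unisecant is a line meeting $\mathscr C$ in exactly one point; an external line is a line disjoint from $\mathscr C$. $G_q$ is the group of all projectivities of $\mathrm{PG}(3,q)$ mapping $\mathscr C$ onto itself. For $a,b,c,d\in\mathbb F_q$, $ad-bc\ne0$, let $$M(a,b,c,d)=\begin{pmatrix} a^3&a^2c&ac^2&c^3\\ 3a^2b&a^2d+2abc&bc^2+2acd&3c^2d\\ 3ab^2&b^2c+2abd&ad^2+2bcd&3cd^2\\ b^3&b^2d&bd^2&d^3\end{pmatrix};$$ the projectivities $\mathbf P(x)\mapsto\mathbf P(xM(a,b,c,d))$ form the subgroup $G_q^*\cong PGL(2,q)$ of $G_q$ (critical subgroup). Line types (for $q\not\equiv0\pmod 3$): RC = real chord; Tr = tangent; IC = imaginary chord; RA = real axis; IA = imaginary axis; U$\Gamma$ = unisecant which is not a tangent and is contained in some $\Gamma$-plane; Un$\Gamma$ = unisecant contained in no $\Gamma$-plane; E$\Gamma$ = external line contained in exactly one $\Gamma$-plane; En$\Gamma$ = external line contained in no $\Gamma$-plane that is neither an imaginary chord nor an imaginary axis. Known fact for $q=4$: under $G_4^*$ the U$\Gamma$-lines form two orbits, of sizes $5$ and $15$, and the En$\Gamma$-lines form seven orbits, three of size $20$ and four of size $30$; each other line type forms a single $G_4^*$-orbit. *)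

(* Defs.v *)
From HB Require Import structures.
From mathcomp Require Import all_boot all_order all_algebra all_field.
Set Implicit Arguments. Unset Strict Implicit. Unset Printing Implicit Defensive.
Import GRing.Theory.
Local Open Scope ring_scope.

Definition rv4 (R : nzRingType) (a b c d : R) : 'rV[R]_4 :=
  \row_(i < 4) nth 0 [:: a; b; c; d] i.
Definition cpt (R : nzRingType) (t : R) : 'rV[R]_4 := rv4 (t ^+ 3) (t ^+ 2) t 1.
(* coefficients of the osculating plane pi(1,-3t,3t^2,-t^3) *)
Definition cosc (R : nzRingType) (t : R) : 'rV[R]_4 :=
  rv4 1 (- (3%:R * t)) (3%:R * t ^+ 2) (- t ^+ 3).
(* second point P(3t^2,2t,1,0) of the tangent *)
Definition ctan (R : nzRingType) (t : R) : 'rV[R]_4 := rv4 (3%:R * t ^+ 2) (2%:R * t) 1 0.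
Definition xc (R : nzRingType) (v : 'rV[R]_4) (i : nat) : R := v ord0 (inord i).

Section Geometry.
Variable F : finFieldType.
Local Notation vec := ('rV[F]_4).

(* Points of PG(3,q) are nonzero vectors up to scalars; subspaces (lines, planes)
   are represented by the finite set of all vectors they contain. *)
Definition Pt (t : option F) : vec := if t is Some s then cpt s else rv4 1 0 0 0.
Definition Osc (t : option F) : vec := if t is Some s then cosc s else rv4 0 0 0 1.
Definition TanDir (t : option F) : vec := if t is Some s then ctan s else rv4 0 1 0 0.

Definition spanS m (U : 'M[F]_(m, 4)) : {set vec} := [set v : vec | (v <= U)%MS].
Definition span2 (u w : vec) : {set vec} := spanS (col_mx u w).
Definition is_line (L : {set vec}) : bool :=
  [exists U : 'M[F]_4, (\rank U == 2)%N && (L == spanS U)].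
Definition lines : {set {set vec}} := [set L | is_line L].
Definition gplane (t : option F) : {set vec} := [set v : vec | v *m (Osc t)^T == 0].
Definition on_C (L : {set vec}) : {set option F} := [set t | Pt t \in L].
Definition nGamma (L : {set vec}) : nat := #|[set t : option F | L \subset gplane t]|.
Definition unisecant (L : {set vec}) : bool := #|on_C L| == 1%N.
Definition external (L : {set vec}) : bool := #|on_C L| == 0%N.

Definition RC : {set {set vec}} :=
  [set L in lines | [exists s, exists t, (s != t) && (L == span2 (Pt s) (Pt t))]].
Definition Tr : {set {set vec}} :=
  [set L in lines | [exists t, L == span2 (Pt t) (TanDir t)]].
Definition RA : {set {set vec}} :=
  [set L in lines | [exists s, exists t, (s != t) && (L == gplane s :&: gplane t)]].
Definition UG : {set {set vec}} :=
  [set L in lines | [&& unisecant L, L \notin Tr & (0 < nGamma L)%N]].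
Definition UnG : {set {set vec}} := [set L in lines | unisecant L && (nGamma L == 0)%N].
Definition EG : {set {set vec}} := [set L in lines | external L && (nGamma L == 1)%N].

(* Imaginary chords / axes: K plays the role of F_{q^2}, f the embedding F_q -> F_{q^2}.
   The line of PG(3,q) corresponding to a line of PG(3,q^2) defined over F_q
   is the set of its F_q-rational vectors. *)
Variables (K : finFieldType) (f : {rmorphism F -> K}).
Definition notinF (a : K) : bool := ~~ [exists b : F, a == f b].
Definition IC : {set {set vec}} :=
  [set L in lines | [exists a : K, notinF a &&
     (L == [set v : vec | (map_mx f v <= col_mx (cpt a) (cpt (a ^+ #|F|)))%MS])]].
Definition IA : {set {set vec}} :=
  [set L in lines | [exists a : K, notinF a &&
     (L == [set v : vec | (map_mx f v *m (cosc a)^T == 0)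
                          && (map_mx f v *m (cosc (a ^+ #|F|))^T == 0)])]].
Definition EnG : {set {set vec}} :=
  [set L in lines | [&& external L, (nGamma L == 0)%N, L \notin IC & L \notin IA]].

Definition img (A : 'M[F]_4) (L : {set vec}) : {set vec} := [set v *m A | v in L].
Definition Gq : {set 'M[F]_4} :=
  [set A : 'M[F]_4 | [&& A \in unitmx,
      [forall t, exists s, (Pt t *m A == Pt s)%MS] &
      [forall s, exists t, (Pt t *m A == Pt s)%MS]]].
Definition Mabcd (a b c d : F) : 'M[F]_4 :=
  \matrix_(i < 4, j < 4) nth 0 (nth [::] [::
    [:: a ^+ 3; a ^+ 2 * c; a * c ^+ 2; c ^+ 3];
    [:: 3%:R * a ^+ 2 * b; a ^+ 2 * d + 2%:R * a * b * c;
        b * c ^+ 2 + 2%:R * a * c * d; 3%:R * c ^+ 2 * d];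
    [:: 3%:R * a * b ^+ 2; b ^+ 2 * c + 2%:R * a * b * d;
        a * d ^+ 2 + 2%:R * b * c * d; 3%:R * c * d ^+ 2];
    [:: b ^+ 3; b ^+ 2 * d; b * d ^+ 2; d ^+ 3]] i) j.
Definition orbG (L : {set vec}) : {set {set vec}} := [set img A L | A in Gq].
(* orbit of L under the critical subgroup G_q^* *)
Definition orbS (L : {set vec}) : {set {set vec}} :=
  [set L' : {set vec} | [exists a, exists b, exists c, exists d,
      (a * d - b * c != 0) && (L' == img (Mabcd a b c d) L)]].
Definition isGorbit (O : {set {set vec}}) : bool := [exists L in lines, O == orbG L].

End Geometry.

(* Main.v *)
Require Import Defs.
From HB Require Import structures.
From mathcomp Require Import all_boot all_order all_algebra all_field.
From mathcomp Require Import ring.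
Set Implicit Arguments. Unset Strict Implicit. Unset Printing Implicit Defensive.

(* A field F with four elements is {a + b w} with w^2 = w + 1, so that the
   statement is about the finite geometry PG(3,4), which has 357 lines, one for
   each 2x4 reduced echelon form.  A matrix preserving the cubic sends the basis
   P(oo), P(0), P(1), P(w), whose sum is the fifth point, to multiples of points of
   the cubic: trying all such images leaves 120 projectivities.  The orbits are
   then found by enumeration; since they partition the lines, one representative
   of each suffices.  An imaginary chord or axis, given by a in K outside F, only depends
   on the minimal polynomial X^2 + pX + r of a over F, and is cut out by two linear
   equations with coefficients in F; all six irreducible polynomials occur. *)

(** * The finite model *)

(** The field F is abstract and its finite sets do not evaluate, so every set of the statement is
    carried over to a list on which counting and comparison are plain computations. This needs a
    unique datum per line; the reduced echelon form provides it, and the scalar ambiguity of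
    matrices disappears because a matrix and its nonzero multiples move lines in the same way. The
    shape of the answer has a conceptual reason. The five points of the cubic form a frame of
    PG(3,4), so each of their permutations is induced by exactly one projectivity: G_4 is the
    symmetric group S_5 of order 120, and G_4^*, isomorphic to PGL(2,4) and to A_5, is normal of
    index 2. Hence a G_4-orbit is either one G_4^*-orbit or the union of two of equal size. The
    computation decides which case occurs. *)

(* (a, b) stands for a + b w, where w^2 = w + 1. *)
Definition gf4 := (bool * bool)%type.
Definition g0 : gf4 := (false, false).
Definition g1 : gf4 := (true, false).
Definition gw : gf4 := (false, true).
Definition gadd (x y : gf4) : gf4 := (x.1 (+) y.1, x.2 (+) y.2).
(** Multiplication by w: w (a + b w) = b + (a + b) w. *)
Definition gshift (x : gf4) : gf4 := (x.2, x.1 (+) x.2).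
Definition gmul (x y : gf4) : gf4 :=
  match x with
  | (false, false) => g0
  | (true, false) => y
  | (false, true) => gshift y
  | (true, true) => gadd y (gshift y)
  end.
(** Squaring: x^3 = 1 for nonzero x, so the inverse is x^2 = a + b w^2. It sends 0 to 0, in
    agreement with the convention for inverses in F. *)
Definition ginv (x : gf4) : gf4 := (x.1 (+) x.2, x.2).
Definition gf4s : seq gf4 := [:: g0; g1; gw; gadd g1 gw].

Definition vec := (gf4 * gf4 * gf4 * gf4)%type.
Definition vec0 : vec := (g0, g0, g0, g0).
Definition co (i : nat) (v : vec) : gf4 :=
  let: (a, b, c, d) := v in match i with 0 => a | 1 => b | 2 => c | _ => d end.
Definition vadd (u v : vec) : vec :=
  let: (a, b, c, d) := u in let: (a', b', c', d') := v in
  (gadd a a', gadd b b', gadd c c', gadd d d').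
Definition vscale (x : gf4) (v : vec) : vec :=
  let: (a, b, c, d) := v in (gmul x a, gmul x b, gmul x c, gmul x d).
Definition dot (u v : vec) : gf4 :=
  let: (a, b, c, d) := u in let: (a', b', c', d') := v in
  gadd (gadd (gmul a a') (gmul b b')) (gadd (gmul c c') (gmul d d')).
Definition vecs : seq vec :=
  [seq (x, d) | x <- [seq (x, c) | x <- [seq (a, b) | a <- gf4s, b <- gf4s], c <- gf4s], d <- gf4s].

Definition mat := (vec * vec * vec * vec)%type.
Definition vmul (v : vec) (M : mat) : vec :=
  let: (a, b, c, d) := v in let: (r0, r1, r2, r3) := M in
  vadd (vadd (vscale a r0) (vscale b r1)) (vadd (vscale c r2) (vscale d r3)).
Definition mmul (M N : mat) : mat :=
  let: (r0, r1, r2, r3) := M in (vmul r0 N, vmul r1 N, vmul r2 N, vmul r3 N).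

(* A pair of vectors stands for the line that it spans. *)
Definition gens := (vec * vec)%type.
Definition comb (a b : gf4) (p : gens) : vec := vadd (vscale a p.1) (vscale b p.2).
Definition gmem (p : gens) (v : vec) : bool :=
  has (fun a => has (fun b => v == comb a b p) gf4s) gf4s.
(** The Pluecker coordinates of the line; the sign of the determinant is lost in characteristic
    2. *)
Definition minor (ij : nat * nat) (p : gens) : gf4 :=
  gadd (gmul (co ij.1 p.1) (co ij.2 p.2)) (gmul (co ij.2 p.1) (co ij.1 p.2)).
(** The lexicographic order matters: the first pair with a nonzero minor is then the pair of pivot
    columns of the reduced echelon form. *)
Definition pivots : seq (nat * nat) := [:: (0, 1); (0, 2); (0, 3); (1, 2); (1, 3); (2, 3)]%N.
Definition indep (p : gens) : bool := has (fun ij => minor ij p != g0) pivots.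
(* Row reduction with pivot columns ij, written so that each entry is a quotient of
   two minors of p: a change of generators scales all minors by the same factor,
   so the result only depends on the line. *)
Definition canon_at (ij : nat * nat) (p : gens) : gens :=
  let x := ginv (minor ij p) in
  (vscale x (comb (co ij.2 p.2) (co ij.2 p.1) p), vscale x (comb (co ij.1 p.2) (co ij.1 p.1) p)).
(** For a dependent pair the search runs off [pivots] and returns the default columns [(0, 0)]; the
    results on [canon] therefore ask for [indep]. *)
Definition canon (p : gens) : gens :=
  canon_at (nth (0, 0)%N pivots (find (fun ij => minor ij p != g0) pivots)) p.

(** One block for each pair of pivot columns, in the order of [pivots]: 256 + 64 + 16 + 16 + 4 + 1 =
    357. *)
Definition echelons : seq gens :=
  [seq let: (a, b, c, d) := v in ((g1, g0, a, b), (g0, g1, c, d)) | v <- vecs] ++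
  [seq let: (a, b, c) := v in ((g1, a, g0, b), (g0, g0, g1, c))
    | v <- [seq (x, c) | x <- [seq (a, b) | a <- gf4s, b <- gf4s], c <- gf4s]] ++
  [seq ((g1, a, b, g0), (g0, g0, g0, g1)) | a <- gf4s, b <- gf4s] ++
  [seq ((g0, g1, g0, a), (g0, g0, g1, b)) | a <- gf4s, b <- gf4s] ++
  [seq ((g0, g1, a, g0), (g0, g0, g0, g1)) | a <- gf4s] ++
  [:: ((g0, g0, g1, g0), (g0, g0, g0, g1))].

Definition params : seq (option gf4) := None :: map Some gf4s.
Definition mPt (t : option gf4) : vec :=
  if t is Some s then (gmul s (gmul s s), gmul s s, s, g1) else (g1, g0, g0, g0).
(** Here and in [mTan] the coefficients are reduced modulo 2: 3 becomes 1, 2 becomes 0 and signs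
    vanish. *)
Definition mOsc (t : option gf4) : vec :=
  if t is Some s then (g1, s, gmul s s, gmul s (gmul s s)) else (g0, g0, g0, g1).
Definition mTan (t : option gf4) : vec :=
  if t is Some s then (gmul s s, g0, g1, g0) else (g0, g1, g0, g0).

Definition units : seq gf4 := [:: g1; gw; gadd g1 gw].
Definition proj_eq (u v : vec) : bool := has (fun c => u == vscale c v) units.
Definition preserves (M : mat) : bool :=
  all (fun t => has (fun s => proj_eq (vmul (mPt t) M) (mPt s)) params) (rev params) &&
  all (fun s => has (fun t => proj_eq (vmul (mPt t) M) (mPt s)) params) params.

(* The inverse of the matrix with rows P(oo), P(0), P(1), P(w). *)
Definition basis_inv : mat :=
  let v := gadd g1 gw in
  ((g1, g0, g0, g0), (v, v, gw, g1), (gw, gw, v, g1), (g0, g1, g0, g0)).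
Definition cone : seq vec := [seq vscale c (mPt s) | c <- units, s <- params].
(* The possible images of P(oo), P(0), P(1), P(w) under a matrix preserving the
   cubic, scaled so that the coefficient of the first image is 1. *)
Definition frames : seq mat :=
  [seq (x, r3) |
    x <- [seq (x, r2) | x <- [seq (mPt s, r1) | s <- params, r1 <- cone], r2 <- cone],
    r3 <- cone].
(* P(w^2) = P(oo) + P(0) + P(1) + P(w). *)
Definition fifth (M : mat) : bool :=
  let: (r0, r1, r2, r3) := M in vadd (vadd r0 r1) (vadd r2 r3) \in cone.
Definition projectivities : seq mat :=
  [seq M <- [seq mmul basis_inv R | R <- frames & fifth R] | preserves M].
Definition critical (v : vec) : mat :=
  let: (a, b, c, d) := v in
  let aa := gmul a a in let bb := gmul b b in let cc := gmul c c in let dd := gmul d d in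
  ((gmul aa a, gmul aa c, gmul a cc, gmul cc c),
   (gmul aa b, gmul aa d, gmul b cc, gmul cc d),
   (gmul a bb, gmul bb c, gmul a dd, gmul c dd),
   (gmul bb b, gmul bb d, gmul b dd, gmul dd d)).
(** The 180 elements of GL(2,4) give each matrix three times, since scaling (a, b, c, d) by x
    multiplies the matrix by x^3 = 1. *)
Definition criticals : seq mat :=
  [seq critical v | v <- vecs & let: (a, b, c, d) := v in gadd (gmul a d) (gmul b c) != g0].
Definition pmul (p : gens) (M : mat) : gens := (vmul p.1 M, vmul p.2 M).
(** Matrices with the same effect on the line give the same echelon form; after [undup] the length
    is the size of the orbit. *)
Definition images (Ms : seq mat) (p : gens) : seq gens :=
  undup [seq canon (pmul p M) | M <- Ms].
Definition add_orbit (Ms : seq mat) (os : seq (seq gens)) (p : gens) : seq (seq gens) :=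
  if has (fun o : seq gens => p \in o) os then os else images Ms p :: os.
Definition orbits (Ms : seq mat) : seq (seq gens) := foldl (add_orbit Ms) [::] echelons.

Definition incidence (p : gens) : nat := count (fun t => gmem p (mPt t)) params.
Definition osculation (p : gens) : nat :=
  count (fun t => (dot p.1 (mOsc t) == g0) && (dot p.2 (mOsc t) == g0)) params.
Definition annihilates (p : gens) (c c' : vec) : bool :=
  [&& dot p.1 c == g0, dot p.1 c' == g0, dot p.2 c == g0 & dot p.2 c' == g0].
(* The first of many such lines if c and c' are dependent; excluded by zeros_spec. *)
Definition zeros (c c' : vec) : gens :=
  nth (vec0, vec0) echelons (find (fun p => annihilates p c c') echelons).
Definition zeros_spec (c c' : vec) : bool :=
  let p := zeros c c' in
  (p \in echelons) && all (fun v => gmem p v == ((dot v c == g0) && (dot v c' == g0))) vecs.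
Definition distinct_params : seq (option gf4 * option gf4) :=
  [seq st <- [seq (s, t) | s <- params, t <- params] | st.1 != st.2].
Definition chords : seq gens := undup [seq canon (mPt st.1, mPt st.2) | st <- distinct_params].
Definition axes : seq gens := undup [seq zeros (mOsc st.1) (mOsc st.2) | st <- distinct_params].
Definition tangents : seq gens := [seq canon (mPt t, mTan t) | t <- params].
Definition irreducibles : seq (gf4 * gf4) :=
  [seq pr <- [seq (p, r) | p <- gf4s, r <- gf4s]
    | all (fun x => gadd (gadd (gmul x x) (gmul pr.1 x)) pr.2 != g0) gf4s].
(* If a^2 = p a + r then (a^3, a^2, a, 1) satisfies both equations. *)
Definition ichord_eqs (pr : gf4 * gf4) : vec * vec :=
  ((g1, pr.1, pr.2, g0), (g0, g1, pr.1, pr.2)).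
(* The coefficients of 1 and a in x_0 + a x_1 + a^2 x_2 + a^3 x_3 when a^2 = p a + r. *)
Definition iaxis_eqs (pr : gf4 * gf4) : vec * vec :=
  ((g1, g0, pr.2, gmul pr.1 pr.2), (g0, g1, pr.1, gadd (gmul pr.1 pr.1) pr.2)).
Definition ichords : seq gens :=
  [seq zeros (ichord_eqs pr).1 (ichord_eqs pr).2 | pr <- irreducibles].
Definition iaxes : seq gens :=
  [seq zeros (iaxis_eqs pr).1 (iaxis_eqs pr).2 | pr <- irreducibles].

Definition UG_list :=
  [seq p <- echelons | [&& incidence p == 1%N, p \notin tangents & 0 < osculation p]].
Definition UnG_list :=
  [seq p <- echelons | (incidence p == 1%N) && (osculation p == 0%N)].
Definition EG_list :=
  [seq p <- echelons | (incidence p == 0%N) && (osculation p == 1%N)].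
Definition EnG_list :=
  [seq p <- echelons |
    [&& incidence p == 0%N, osculation p == 0%N, p \notin ichords & p \notin iaxes]].

(** Both orbit tables are stored in evaluated form, so that the later checks search them instead of
    enumerating the orbits again. *)
Definition orbitsG : seq (seq gens) := Eval vm_compute in orbits projectivities.
Definition orbitsS : seq (seq gens) := Eval vm_compute in orbits criticals.
Lemma orbitsGE : orbitsG = orbits projectivities.
Proof. by apply/eqP; vm_compute. Qed.
Lemma orbitsSE : orbitsS = orbits criticals.
Proof. by apply/eqP; vm_compute. Qed.

Import GRing.Theory.
Local Open Scope ring_scope.

(** * Coordinates over a field with four elements *)

Lemma rowP4 (R : nzRingType) (u w : 'rV[R]_4) :
  (forall i : nat, (i < 4)%N -> u 0 (inord i) = w 0 (inord i)) -> u = w.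
Proof. by move=> h; apply/rowP => i; rewrite -(inord_val i) h. Qed.

Lemma rv4E (R : nzRingType) (a b c d : R) i : (i < 4)%N ->
  rv4 a b c d 0 (inord i) = nth 0 [:: a; b; c; d] i.
Proof. by move=> hi; rewrite mxE inordK. Qed.

Lemma rv4_eta (R : nzRingType) (v : 'rV[R]_4) : v = rv4 (xc v 0) (xc v 1) (xc v 2) (xc v 3).
Proof. by apply: rowP4 => -[|[|[|[|]]]] // hi; rewrite rv4E. Qed.

Lemma xc_rv4 (R : nzRingType) (a b c d : R) i : (i < 4)%N ->
  xc (rv4 a b c d) i = nth 0 [:: a; b; c; d] i.
Proof. exact: rv4E. Qed.

Lemma rv4D (R : nzRingType) (a b c d a' b' c' d' : R) :
  rv4 a b c d + rv4 a' b' c' d' = rv4 (a + a') (b + b') (c + c') (d + d').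
Proof. by apply: rowP4 => -[|[|[|[|]]]] // hi; rewrite mxE !rv4E. Qed.

Lemma rv4Z (R : nzRingType) (x a b c d : R) :
  x *: rv4 a b c d = rv4 (x * a) (x * b) (x * c) (x * d).
Proof. by apply: rowP4 => -[|[|[|[|]]]] // hi; rewrite mxE !rv4E. Qed.

Lemma rv4_inj (R : nzRingType) (a b c d a' b' c' d' : R) :
  rv4 a b c d = rv4 a' b' c' d' -> [/\ a = a', b = b', c = c' & d = d'].
Proof.
move=> e; have h i (hi : (i < 4)%N) := congr1 (fun v : 'rV_4 => xc v i) e.
by split; [have := h 0%N isT | have := h 1%N isT | have := h 2%N isT | have := h 3%N isT];
  rewrite !xc_rv4.
Qed.

Lemma rv4_mul_tr (R : comNzRingType) (a b c d a' b' c' d' : R) :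
  (rv4 a b c d *m (rv4 a' b' c' d')^T == 0) = (a * a' + b * b' + (c * c' + d * d') == 0).
Proof.
set s := (X in _ = (X == 0)).
have -> : rv4 a b c d *m (rv4 a' b' c' d')^T = s%:M.
  apply/matrixP => i j; rewrite !mxE !ord1 /= !big_ord_recl big_ord0 !mxE /=.
  by rewrite ?mulr1n addr0 addrA.
apply/eqP/eqP => [/matrixP/(_ 0 0)|->]; last by rewrite rmorph0.
by rewrite !mxE mulr1n.
Qed.

Lemma mem_span2 (F : finFieldType) (u w v : 'rV[F]_4) :
  reflect (exists a b, v = a *: u + b *: w) (v \in span2 u w).
Proof.
rewrite inE; apply: (iffP submxP) => [[D ->]|[a [b ->]]].
  exists (lsubmx D 0 0), (rsubmx D 0 0).
  by rewrite -{1}[D]hsubmxK mul_row_col [X in X *m _ + _]mx11_scalar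
    [X in _ + X *m _]mx11_scalar !mul_scalar_mx.
by exists (row_mx a%:M b%:M); rewrite mul_row_col !mul_scalar_mx.
Qed.

Section Coordinates.
Variables (F : finFieldType) (th : F).
Hypotheses (cardF : #|F| = 4%N) (thE : th ^+ 2 = th + 1).

(** Every x in F satisfies x^4 = x; for x = -1 the left side is 1. *)
Lemma two0 : 1 + 1 = 0 :> F.
Proof.
have := expf_card (-1 : F); rewrite cardF -signr_odd /= expr0 => e.
by rewrite [X in X + _]e addNr.
Qed.

Lemma addxx (x : F) : x + x = 0.
Proof. by rewrite -[x]mulr1 -mulrDr two0 mulr0. Qed.

Lemma oppx (x : F) : - x = x.
Proof. by apply/eqP; rewrite eq_sym -addr_eq0 addxx. Qed.

Definition phi (x : gf4) : F := x.1%:R + x.2%:R * th.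

Lemma natr_addb (a b : bool) : (a (+) b)%:R = a%:R + b%:R :> F.
Proof. by case: a b => [] []; rewrite /= ?addr0 ?add0r ?two0. Qed.

Lemma phiD : {morph phi : x y / gadd x y >-> x + y}.
Proof. by move=> x y; rewrite /phi /= !natr_addb; ring. Qed.

Lemma phi_shift x : phi (gshift x) = th * phi x.
Proof.
rewrite /phi /= natr_addb.
have -> : th * (x.1%:R + x.2%:R * th) = x.1%:R * th + x.2%:R * th ^+ 2 by ring.
by rewrite thE; ring.
Qed.

Lemma phi0 : phi g0 = 0. Proof. by rewrite /phi /= mul0r addr0. Qed.
Lemma phi1 : phi g1 = 1. Proof. by rewrite /phi /= mul0r addr0. Qed.

Lemma phiM : {morph phi : x y / gmul x y >-> x * y}.
Proof.
case=> [[] []] y; rewrite /= ?phiD ?phi_shift ?phi0 /phi /=; ring.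
Qed.

Lemma phi_eq0 x : (phi x == 0) = (x == g0).
Proof.
have th0 : th != 0.
  by apply/eqP => h; move: thE; rewrite h expr0n add0r => /esym/eqP; rewrite oner_eq0.
case: x => [[] []]; rewrite /phi /= ?mul0r ?mul1r ?addr0 ?add0r ?oner_eq0 ?(negPf th0) ?eqxx //.
(* The remaining element 1 + [th] equals [th ^+ 2], so its vanishing would force [th] = 0. *)
apply/eqP => h; move: thE; rewrite [th + 1]addrC h => /eqP; rewrite expf_eq0 /=.
by rewrite (negPf th0).
Qed.

Lemma gadd_eq0 x y : (gadd x y == g0) = (x == y).
Proof. by case: x y => [[] []] [[] []]. Qed.

Lemma phi_inj : injective phi.
Proof.
by move=> x y e; apply/eqP; rewrite -gadd_eq0 -phi_eq0 phiD e addxx.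
Qed.

Lemma phi_surj x : exists y, x = phi y.
Proof.
have : bijective phi by apply: (inj_card_bij phi_inj); rewrite card_prod card_bool cardF.
by case=> g _ gK; exists (g x); rewrite gK.
Qed.

Lemma phiV x : phi (ginv x) = (phi x)^-1.
Proof.
have [->|x0] := eqVneq x g0; first by rewrite [ginv _]/= phi0 invr0.
apply: (mulIf (x := phi x)); first by rewrite phi_eq0.
rewrite mulVf ?phi_eq0 // -phiM -phi1; congr phi.
by case: x x0 => [[] []].
Qed.

Arguments gadd : simpl never.
Arguments gmul : simpl never.
Arguments ginv : simpl never.

Definition vphi (v : vec) : 'rV[F]_4 :=
  let: (a, b, c, d) := v in rv4 (phi a) (phi b) (phi c) (phi d).

Lemma vphiD : {morph vphi : u v / vadd u v >-> u + v}.
Proof. by case=> [[[a b] c] d] [[[a' b'] c'] d']; rewrite /vphi /= rv4D !phiD. Qed.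

Lemma vphiZ x v : vphi (vscale x v) = phi x *: vphi v.
Proof. by case: v => [[[a b] c] d]; rewrite /vphi /= rv4Z !phiM. Qed.

Lemma vphi_inj : injective vphi.
Proof.
by case=> [[[a b] c] d] [[[a' b'] c'] d'] /rv4_inj [] /phi_inj-> /phi_inj-> /phi_inj-> /phi_inj->.
Qed.

Lemma vphi_surj v : exists u, v = vphi u.
Proof.
have [a Ea] := phi_surj (xc v 0); have [b Eb] := phi_surj (xc v 1).
have [c Ec] := phi_surj (xc v 2); have [d Ed] := phi_surj (xc v 3).
by exists (a, b, c, d); rewrite [LHS]rv4_eta Ea Eb Ec Ed.
Qed.

Lemma vphi_comb a b p : vphi (comb a b p) = phi a *: vphi p.1 + phi b *: vphi p.2.
Proof. by rewrite /comb vphiD !vphiZ. Qed.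

Lemma vphi0 : vphi vec0 = 0.
Proof. by rewrite /vphi /= phi0 [RHS]rv4_eta /xc !mxE. Qed.

Lemma xc_vphi v i : (i < 4)%N -> xc (vphi v) i = phi (co i v).
Proof. by case: v => [[[a b] c] d] hi; rewrite xc_rv4 //; case: i hi => [|[|[|[|]]]]. Qed.

Lemma vphi_dot v c : (vphi v *m (vphi c)^T == 0) = (dot v c == g0).
Proof.
case: v c => [[[a b] c] d] [[[a' b'] c'] d']; rewrite rv4_mul_tr -phi_eq0 /=.
by rewrite !phiD !phiM.
Qed.

Lemma mem_gf4s x : x \in gf4s.
Proof. by case: x => [[] []]. Qed.

Lemma mem_vecs v : v \in vecs.
Proof.
by case: v => [[[a b] c] d]; do 3!(apply: allpairs_f; last exact: mem_gf4s); exact: mem_gf4s.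
Qed.

Lemma has_gf4s (P : pred gf4) : reflect (exists x, P x) (has P gf4s).
Proof.
apply: (iffP hasP) => [[x _ Px]|[x Px]]; exists x => //; exact: mem_gf4s.
Qed.

Definition D (p : gens) : {set 'rV[F]_4} := span2 (vphi p.1) (vphi p.2).

Lemma gmemP p v : reflect (exists a b, v = comb a b p) (gmem p v).
Proof.
apply: (iffP (has_gf4s _)) => [[a /has_gf4s [b /eqP ->]]|[a [b ->]]].
  by exists a, b.
by exists a; apply/has_gf4s; exists b.
Qed.

Lemma mem_D p v : (vphi v \in D p) = gmem p v.
Proof.
apply/mem_span2/gmemP => [[a [b e]]|[a [b ->]]].
  have [a' Ea] := phi_surj a; have [b' Eb] := phi_surj b.
  by exists a', b'; apply: vphi_inj; rewrite vphi_comb -Ea -Eb.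
by exists (phi a), (phi b); rewrite vphi_comb.
Qed.

Lemma eqD (L : {set 'rV[F]_4}) p : (forall v, (vphi v \in L) = gmem p v) -> L = D p.
Proof. by move=> h; apply/setP => v; have [u ->] := vphi_surj v; rewrite h mem_D. Qed.

(** * Pluecker coordinates and reduced generators *)

Lemma co_vadd i u v : co i (vadd u v) = gadd (co i u) (co i v).
Proof. by case: u v => [[[a b] c] d] [[[a' b'] c'] d']; case: i => [|[|[|]]]. Qed.

Lemma co_vscale i x v : co i (vscale x v) = gmul x (co i v).
Proof. by case: v => [[[a b] c] d]; case: i => [|[|[|]]]. Qed.

Lemma co_comb i a b p : co i (comb a b p) = gadd (gmul a (co i p.1)) (gmul b (co i p.2)).
Proof. by rewrite /comb co_vadd !co_vscale. Qed.

Lemma eq_vec u v : (forall i, (i < 4)%N -> co i u = co i v) -> u = v.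
Proof.
move=> h; have := (h 0 isT, h 1 isT, h 2 isT, h 3 isT).
by case: u v {h} => [[[a b] c] d] [[[a' b'] c'] d'] /= [[[-> ->] ->] ->].
Qed.

Definition lcomb (a b c d : gf4) (p : gens) : gens := (comb a b p, comb c d p).
Definition gdet (a b c d : gf4) : gf4 := gadd (gmul a d) (gmul b c).

Lemma minor_lcomb ij a b c d p :
  minor ij (lcomb a b c d p) = gmul (gdet a b c d) (minor ij p).
Proof.
apply: phi_inj; rewrite /minor /gdet /= !co_comb !(phiD, phiM).
set ui := phi (co _ p.1); set wj := phi (co _ p.2).
set uj := phi (co _ p.1); set wi := phi (co _ p.2).
(* The two sides differ by an even multiple of a polynomial. *)
rewrite -[RHS]addr0 -(mul0r (phi a * phi c * ui * uj + phi b * phi d * wi * wj)) -two0.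
ring.
Qed.

(** Cramer's rule: eliminating the second pivot column from column k leaves the minor of those two
    columns. *)
Lemma co_canon_at1 k ij p :
  co k (canon_at ij p).1 = gmul (ginv (minor ij p)) (minor (k, ij.2) p).
Proof.
apply: phi_inj; rewrite /canon_at /= co_vscale co_comb /minor /=.
by rewrite !(phiD, phiM); ring.
Qed.

Lemma co_canon_at2 k ij p :
  co k (canon_at ij p).2 = gmul (ginv (minor ij p)) (minor (ij.1, k) p).
Proof.
apply: phi_inj; rewrite /canon_at /= co_vscale co_comb /minor /=.
by rewrite !(phiD, phiM); ring.
Qed.

Lemma gmul_eq0 x y : (gmul x y == g0) = (x == g0) || (y == g0).
Proof. by rewrite -!phi_eq0 phiM mulf_eq0. Qed.

Lemma eq_gens (p p' : gens) :
  (forall k, (k < 4)%N -> co k p.1 = co k p'.1 /\ co k p.2 = co k p'.2) -> p = p'.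
Proof.
by case: p p' => [u w] [u' w'] h; congr pair; apply: eq_vec => k /h[].
Qed.

Lemma canon_at_lcomb ij a b c d p : gdet a b c d != g0 -> minor ij p != g0 ->
  canon_at ij (lcomb a b c d p) = canon_at ij p.
Proof.
rewrite -!phi_eq0 => d0 m0; apply: eq_gens => k _.
rewrite !co_canon_at1 !co_canon_at2 !minor_lcomb.
by split; apply: phi_inj; rewrite !phiM; rewrite !phiV !phiM; field; rewrite d0 m0.
Qed.

Lemma indepP p : reflect (exists2 ij, ij \in pivots & minor ij p != g0) (indep p).
Proof. exact: hasP. Qed.

Lemma canon_lcomb a b c d p : gdet a b c d != g0 -> indep p ->
  canon (lcomb a b c d p) = canon p.
Proof.
move=> d0 ip; rewrite /canon.
have -> : find (fun ij => minor ij (lcomb a b c d p) != g0) pivots =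
          find (fun ij => minor ij p != g0) pivots.
  by apply: eq_find => ij; rewrite minor_lcomb gmul_eq0 (negPf d0).
by apply: canon_at_lcomb => //; exact: (nth_find (0, 0)%N ip).
Qed.

Lemma comb_lcomb x y a b c d p : comb x y (lcomb a b c d p) =
  comb (gadd (gmul x a) (gmul y c)) (gadd (gmul x b) (gmul y d)) p.
Proof.
apply: eq_vec => i _; apply: phi_inj.
by rewrite !co_comb /= ?co_comb !(phiD, phiM); ring.
Qed.

Lemma gmem_lcomb a b c d p v : gmem (lcomb a b c d p) v -> gmem p v.
Proof.
by move=> /gmemP[x [y ->]]; rewrite comb_lcomb; apply/gmemP; do 2!eexists.
Qed.

Lemma comb10 p : comb g1 g0 p = p.1.
Proof.
apply: eq_vec => i _; apply: phi_inj.
by rewrite co_comb !(phiD, phiM, phi0, phi1) mul1r mul0r addr0.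
Qed.

Lemma comb01 p : comb g0 g1 p = p.2.
Proof.
apply: eq_vec => i _; apply: phi_inj.
by rewrite co_comb !(phiD, phiM, phi0, phi1) mul1r mul0r add0r.
Qed.

Lemma lcomb_id p : lcomb g1 g0 g0 g1 p = p.
Proof. by rewrite /lcomb comb10 comb01; case: p. Qed.

Lemma D_lcomb a b c d p : gdet a b c d != g0 -> D (lcomb a b c d p) = D p.
Proof.
move=> d0; apply: eqD => v; rewrite mem_D; apply/idP/idP => [/gmem_lcomb //|].
set x := ginv (gdet a b c d).
(* The inverse change of generators is the adjugate divided by the determinant, without signs in
   characteristic 2. The inclusion already known for any change of generators then applies in the
   other direction. *)
have E : p = lcomb (gmul x d) (gmul x b) (gmul x c) (gmul x a) (lcomb a b c d p) :> gens.
  rewrite {1}/lcomb !comb_lcomb -/(lcomb _ _ _ _ p) -[LHS]lcomb_id.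
  have two z : z + z = 0 :> F by exact: addxx.
  rewrite -phi_eq0 /gdet phiD !phiM in d0.
  have E1 : phi x * (phi a * phi d + phi b * phi c) = 1.
    by rewrite /x phiV /gdet phiD !phiM mulVf.
  congr lcomb; apply: phi_inj; rewrite !(phiD, phiM, phi0, phi1) -?E1; try ring.
  (* The off-diagonal entries of the product are doubles, which [ring] alone does not recognise as
     zero. *)
  - by rewrite -[LHS](two (phi x * phi b * phi d)); ring.
  - by rewrite -[LHS](two (phi x * phi a * phi c)); ring.
by rewrite {1}E; exact: gmem_lcomb.
Qed.

Lemma gmem1 p : gmem p p.1.
Proof. by apply/gmemP; exists g1, g0; rewrite comb10. Qed.

Lemma gmem2 p : gmem p p.2.
Proof. by apply/gmemP; exists g0, g1; rewrite comb01. Qed.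

Lemma sub_lcomb p p' : D p' = D p -> exists a b c d, p' = lcomb a b c d p.
Proof.
move=> e; have := gmem1 p'; rewrite -mem_D e mem_D => /gmemP[a [b E1]].
have := gmem2 p'; rewrite -mem_D e mem_D => /gmemP[c [d E2]].
by exists a, b, c, d; case: p' E1 E2 {e} => /= u w -> ->.
Qed.

Lemma D_canon_inj p p' : indep p' -> D p' = D p -> canon p' = canon p.
Proof.
move=> ip' /sub_lcomb[a [b [c [d E]]]].
(* A nonzero minor of [p'] is [gdet] times the same minor of [p]; so the change of generators is
   invertible and [p] is independent as well. *)
have /indepP[ij hij] := ip'; rewrite E minor_lcomb gmul_eq0 negb_or => /andP[d0 m0].
by rewrite canon_lcomb //; apply/indepP; exists ij.
Qed.

Lemma canon_atE ij p : let x := ginv (minor ij p) in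
  canon_at ij p = lcomb (gmul x (co ij.2 p.2)) (gmul x (co ij.2 p.1))
                        (gmul x (co ij.1 p.2)) (gmul x (co ij.1 p.1)) p.
Proof.
move=> x; apply: eq_gens => k _; rewrite /canon_at /lcomb /= !co_vscale !co_comb -/x.
by split; apply: phi_inj; rewrite !(phiD, phiM); ring.
Qed.

Lemma D_canon p : indep p -> D (canon p) = D p.
Proof.
move=> ip; rewrite /canon; set ij := nth _ _ _.
have m0 : minor ij p != g0 by exact: (nth_find (0, 0)%N ip).
rewrite canon_atE D_lcomb // -phi_eq0.
rewrite -phi_eq0 in m0.
set x := ginv (minor ij p).
(* The reduction multiplies by the inverse of the pivot block, whose determinant is the inverse of
   the pivot minor. *)
suff -> : phi (gdet (gmul x (co ij.2 p.2)) (gmul x (co ij.2 p.1))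
    (gmul x (co ij.1 p.2)) (gmul x (co ij.1 p.1))) = (phi (minor ij p))^-1.
  by rewrite invr_eq0.
rewrite /gdet /x !(phiD, phiM, phiV).
have Em : phi (minor ij p) = phi (co ij.1 p.1) * phi (co ij.2 p.2) +
    phi (co ij.2 p.1) * phi (co ij.1 p.2) by rewrite phiD !phiM.
by rewrite Em in m0 *; field.
Qed.

Lemma minorxx i p : minor (i, i) p = g0.
Proof. by apply: phi_inj; rewrite phi0 /minor phiD addxx. Qed.

Lemma minorC i j p : minor (i, j) p = minor (j, i) p.
Proof. by apply: phi_inj; rewrite /minor !(phiD, phiM) /= addrC. Qed.

Lemma gmulVx x : x != g0 -> gmul (ginv x) x = g1.
Proof. by case: x => [[] []]. Qed.

Lemma gmulx0 x : gmul x g0 = g0.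
Proof. by case: x => [[] []]. Qed.

(** Every entry is a minor divided by the pivot minor. In the pivot columns this gives 1, or 0 by a
    repeated index. An entry to the left of the pivot of its row is a minor that comes earlier in
    [pivots], hence zero by the choice of the first nonzero one. *)
Lemma canon_echelon p : indep p -> canon p \in echelons.
Proof.
have m3 (a b c : gf4) :
    (a, b, c) \in [seq (x, c) | x <- [seq (a, b) | a <- gf4s, b <- gf4s], c <- gf4s].
  by do 2!(apply: allpairs_f; last exact: mem_gf4s); exact: mem_gf4s.
have inl (s t : seq gens) q : q \in s -> q \in s ++ t by rewrite mem_cat => ->.
have inr (s t : seq gens) q : q \in t -> q \in s ++ t by rewrite mem_cat orbC => ->.
have ech0 (a b c d : gf4) : ((g1, g0, a, b), (g0, g1, c, d)) \in echelons.
  exact: inl (map_f (fun v : vec => let: (a, b, c, d) := v in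
    ((g1, g0, a, b), (g0, g1, c, d))) (mem_vecs (a, b, c, d))).
have ech1 (a b c : gf4) : ((g1, a, g0, b), (g0, g0, g1, c)) \in echelons.
  exact: inr (inl _ _ _ (map_f (fun v : gf4 * gf4 * gf4 => let: (a, b, c) := v in
    ((g1, a, g0, b), (g0, g0, g1, c))) (m3 a b c))).
have ech2 (a b : gf4) : ((g1, a, b, g0), (g0, g0, g0, g1)) \in echelons.
  have h := allpairs_f (fun a b : gf4 => ((g1, a, b, g0), (g0, g0, g0, g1)))
    (mem_gf4s a) (mem_gf4s b).
  exact: (inr _ _ _ (inr _ _ _ (inl _ _ _ h))).
have ech3 (a b : gf4) : ((g0, g1, g0, a), (g0, g0, g1, b)) \in echelons.
  have h := allpairs_f (fun a b : gf4 => ((g0, g1, g0, a), (g0, g0, g1, b)))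
    (mem_gf4s a) (mem_gf4s b).
  exact: (inr _ _ _ (inr _ _ _ (inr _ _ _ (inl _ _ _ h)))).
have ech4 (a : gf4) : ((g0, g1, a, g0), (g0, g0, g0, g1)) \in echelons.
  have h := map_f (fun a : gf4 => ((g0, g1, a, g0), (g0, g0, g0, g1))) (mem_gf4s a).
  exact: (inr _ _ _ (inr _ _ _ (inr _ _ _ (inr _ _ _ (inl _ _ _ h))))).
have ech5 : ((g0, g0, g1, g0), (g0, g0, g0, g1)) \in echelons.
  have h := mem_head ((g0, g0, g1, g0), (g0, g0, g0, g1)) [::].
  exact: (inr _ _ _ (inr _ _ _ (inr _ _ _ (inr _ _ _ (inr _ _ _ h))))).
move=> ip; rewrite /canon; set k := find _ _; have := nth_find (0, 0)%N ip; rewrite -/k.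
have kl : (k < 6)%N by rewrite -[6%N]/(size pivots) -has_find.
have before l : (l < k)%N -> minor (nth (0, 0)%N pivots l) p = g0.
  by move=> /(before_find (0, 0)%N) /negbFE/eqP.
have cn ij : canon_at ij p =
   let f1 k := gmul (ginv (minor ij p)) (minor (k, ij.2) p) in
   let f2 k := gmul (ginv (minor ij p)) (minor (ij.1, k) p) in
   ((f1 0%N, f1 1%N, f1 2%N, f1 3%N), (f2 0%N, f2 1%N, f2 2%N, f2 3%N)).
  rewrite /= -!co_canon_at1 -!co_canon_at2.
  by case: (canon_at ij p) => [[[[? ?] ?] ?] [[[? ?] ?] ?]].
move: before kl; rewrite cn; case: k => [|[|[|[|[|[|k]]]]]] //= before _ m0;
  rewrite (gmulVx m0) !minorxx !gmulx0.
- exact: ech0.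
- rewrite (before 0%N) // gmulx0; exact: ech1.
- rewrite (before 0%N) // (before 1%N) // !gmulx0; exact: ech2.
- rewrite (before 1%N) // (minorC 1 0) (before 0%N) // !gmulx0; exact: ech3.
- rewrite (before 2%N) // (minorC 1 0) (before 0%N) // (before 3%N) // !gmulx0; exact: ech4.
- rewrite (before 2%N) // (before 4%N) // (minorC 2 0) (before 1%N) //.
  rewrite (minorC 2 1) (before 3%N) // !gmulx0; exact: ech5.
Qed.

(** * Lines and their echelon forms *)

Lemma indep_free p (x y : F) : indep p ->
  x *: vphi p.1 + y *: vphi p.2 = 0 -> x = 0 /\ y = 0.
Proof.
move=> /indepP[[i j] _ m0] e.
have [a Ea] := phi_surj x; have [b Eb] := phi_surj y.
have c0 k : phi a * phi (co k p.1) + phi b * phi (co k p.2) = 0.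
  move: e; rewrite Ea Eb -vphi_comb -vphi0 => /vphi_inj/(congr1 (co k)).
  move=> /(congr1 phi); rewrite co_comb phiD !phiM => ->.
  by case: k => [|[|[|k]]]; rewrite /= phi0.
rewrite -phi_eq0 phiD !phiM /= in m0.
split; apply/eqP; rewrite ?Ea ?Eb.
- suff : phi a * (phi (co i p.1) * phi (co j p.2) + phi (co j p.1) * phi (co i p.2)) == 0.
    by rewrite mulf_eq0 (negPf m0) orbF.
  have two : phi (co i p.2) * phi b * phi (co j p.2) = - (phi (co i p.2) * phi b * phi (co j p.2)).
    by rewrite oppx.
  (* Coordinates i and j of the relation are weighted by entries of [p.2] so that the second
     coefficient cancels. *)
  apply/eqP; transitivity (phi (co j p.2) * (phi a * phi (co i p.1) + phi b * phi (co i p.2)) +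
    phi (co i p.2) * (phi a * phi (co j p.1) + phi b * phi (co j p.2))); last first.
    by rewrite !c0 !mulr0 addr0.
  rewrite -[LHS]addr0 -(addxx (phi b * phi (co i p.2) * phi (co j p.2))); ring.
- suff : phi b * (phi (co i p.1) * phi (co j p.2) + phi (co j p.1) * phi (co i p.2)) == 0.
    by rewrite mulf_eq0 (negPf m0) orbF.
  apply/eqP; transitivity (phi (co j p.1) * (phi a * phi (co i p.1) + phi b * phi (co i p.2)) +
    phi (co i p.1) * (phi a * phi (co j p.1) + phi b * phi (co j p.2))); last first.
    by rewrite !c0 !mulr0 addr0.
  rewrite -[LHS]addr0 -(addxx (phi a * phi (co i p.1) * phi (co j p.1))); ring.
Qed.

(** Write u, w for the generators. If all minors vanish then w_i u + u_i w = 0, because its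
    coordinates are minors; freeness gives u_i = 0 for every i, and u = 0 contradicts freeness. *)
Lemma free_indep p :
  (forall x y : F, x *: vphi p.1 + y *: vphi p.2 = 0 -> x = 0 /\ y = 0) -> indep p.
Proof.
move=> free; apply/negPn/negP => /hasPn dep.
have m0 i j : (i < 4)%N -> (j < 4)%N -> minor (i, j) p = g0.
  wlog lij : i j / (i <= j)%N.
    by move=> h hi hj; case: (leqP i j) => [/h|/ltnW/h]; [|rewrite minorC]; apply.
  move=> hi hj; have [->|nij] := eqVneq i j; first exact: minorxx.
  have /dep : (i, j) \in pivots.
    by move: i j lij hi hj nij => [|[|[|[|i]]]] [|[|[|[|j]]]].
  by move/negPn/eqP.
have u0 i : (i < 4)%N -> co i p.1 = g0.
  move=> hi; have : comb (co i p.2) (co i p.1) p = vec0.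
    apply: eq_vec => k hk; transitivity (minor (k, i) p).
      by apply: phi_inj; rewrite co_comb /minor !(phiD, phiM) /=; ring.
    by rewrite m0 //; case: k {hk} => [|[|[|]]].
  move=> /(congr1 vphi); rewrite vphi_comb vphi0 => /free[_ /eqP].
  by rewrite phi_eq0 => /eqP.
have : comb g1 g0 p = vec0.
  by rewrite comb10; apply: eq_vec => k hk; rewrite u0 //; case: k {hk} => [|[|[|]]].
move=> /(congr1 vphi); rewrite vphi_comb vphi0 => /free[/eqP].
by rewrite phi1 oner_eq0.
Qed.

Lemma echelons_indep : all indep echelons.
Proof. by vm_compute. Qed.

Lemma echelons_canon : all (fun p => canon p == p) echelons.
Proof. by vm_compute. Qed.

Lemma linesP L : reflect (exists2 p, p \in echelons & L = D p) (L \in lines F).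
Proof.
rewrite inE; apply: (iffP existsP) => [[U /andP[/eqP rU /eqP ->]]|[p pe ->]].
  have [B [fB eB]] : exists B : 'M[F]_(2, 4), row_free B /\ (B :=: U)%MS.
    suff: exists B : 'M[F]_(\rank U, 4), row_free B /\ (B :=: U)%MS by rewrite rU.
    by exists (row_base U); split; [exact: row_base_free|exact: eq_row_base].
  have [u Eu] := vphi_surj (@usubmx _ 1 1 _ B); have [w Ew] := vphi_surj (@dsubmx _ 1 1 _ B).
  have EB : B = col_mx (vphi u) (vphi w) by rewrite -Eu -Ew vsubmxK.
  have ip : indep (u, w).
    apply: free_indep => x y /= e.
    have e2 : row_mx x%:M y%:M *m (B : 'M_(1 + 1, 4)) = 0 :> 'rV_4.
      by rewrite EB mul_row_col !mul_scalar_mx e.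
    have : row_mx x%:M y%:M = 0 :> 'rV[F]_(1 + 1).
      by apply: (row_free_inj fB); rewrite /= e2 mul0mx.
    rewrite -row_mx0 => /eq_row_mx[/matrixP/(_ 0 0) + /matrixP/(_ 0 0)].
    by rewrite !mxE !mulr1n.
  exists (canon (u, w)); first exact: canon_echelon.
  rewrite D_canon // /D /span2 /= -EB.
  by apply/setP => v; rewrite !inE eB.
have ip := allP echelons_indep p pe.
have fB : row_free (col_mx (vphi p.1) (vphi p.2)).
  apply: inj_row_free => v; rewrite -[v]hsubmxK mul_row_col.
  rewrite [lsubmx v]mx11_scalar [rsubmx v]mx11_scalar !mul_scalar_mx.
  by move=> /(indep_free ip)[-> ->]; rewrite rmorph0 row_mx0.
exists <<col_mx (vphi p.1) (vphi p.2)>>%MS; rewrite mxrank_gen (eqnP fB) eqxx /=.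
by apply/eqP/setP => v; rewrite !inE genmxE.
Qed.

(** * Sets of lines as lists of echelon forms *)

Definition DS (s : seq gens) : {set {set 'rV[F]_4}} := [set L in map D s].

(** An echelon form is its own [canon], and [canon] depends only on the line. *)
Lemma D_inj : {in echelons &, injective D}.
Proof.
move=> p p' pe pe' e; rewrite -(eqP (allP echelons_canon p pe)) -(eqP (allP echelons_canon p' pe')).
by apply: D_canon_inj e; apply: (allP echelons_indep).
Qed.

Lemma mem_lines p : p \in echelons -> D p \in lines F.
Proof. by move=> pe; apply/linesP; exists p. Qed.

Lemma mem_DS s p : {subset s <= echelons} -> p \in echelons -> (D p \in DS s) = (p \in s).
Proof.
move=> se pe; rewrite inE; apply/mapP/idP => [[q qs /D_inj ->] //|ps]; last by exists p.
exact: se.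
Qed.

Lemma DSP s L : reflect (exists2 p, p \in s & L = D p) (L \in DS s).
Proof. by rewrite inE; apply: mapP. Qed.

Lemma card_DS s : uniq s -> {subset s <= echelons} -> #|DS s| = size s.
Proof.
move=> us se; rewrite cardsE; have /card_uniqP -> : uniq (map D s); last by rewrite size_map.
by rewrite map_inj_in_uniq // => p q ps qs; apply: D_inj; apply: se.
Qed.

Lemma eq_DS s t : s =i t -> DS s = DS t.
Proof. by move=> e; apply/setP => L; rewrite !inE; apply: eq_mem_map. Qed.

Lemma DS_inj s t : {subset s <= echelons} -> {subset t <= echelons} -> DS s = DS t -> s =i t.
Proof.
move=> se te e p; have [pe|pe] := boolP (p \in echelons).
  by rewrite -mem_DS // e mem_DS.
by rewrite (negPf (contra (@se p) pe)) (negPf (contra (@te p) pe)).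
Qed.

Lemma DS_cat s t : DS (s ++ t) = DS s :|: DS t.
Proof. by apply/setP => L; rewrite !inE map_cat mem_cat. Qed.

Lemma sub_linesE (X : {set {set 'rV[F]_4}}) s : {subset s <= echelons} ->
  X \subset lines F -> (forall p, p \in echelons -> (D p \in X) = (p \in s)) -> X = DS s.
Proof.
move=> se /subsetP Xl h; apply/setP => L; apply/idP/DSP => [LX|[p ps ->]].
  by have /linesP[p pe EL] := Xl L LX; exists p; rewrite // -h // -EL.
by rewrite h // se.
Qed.

(** * The action of matrices on lines *)

Lemma img_span2 A u w : img A (span2 u w) = span2 (u *m A) (w *m A) :> {set 'rV[F]_4}.
Proof.
apply/setP => v; apply/imsetP/mem_span2 => [[x /mem_span2[a [b ->]] ->]|[a [b ->]]].
  by exists a, b; rewrite mulmxDl !scalemxAl.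
by exists (a *: u + b *: w); [apply/mem_span2; exists a, b | rewrite mulmxDl !scalemxAl].
Qed.

Definition mphi (M : mat) : 'M[F]_4 :=
  let: (r0, r1, r2, r3) := M in \matrix_(i < 4) vphi (nth vec0 [:: r0; r1; r2; r3] i).

Lemma mul_mphi v M : vphi v *m mphi M = vphi (vmul v M).
Proof.
case: v M => [[[a b] c] d] [[[r0 r1] r2] r3]; rewrite mulmx_sum_row.
rewrite !big_ord_recl big_ord0 !rowK !mxE /= !vphiD !vphiZ addr0 !addrA.
done.
Qed.

Lemma img_D M p : img (mphi M) (D p) = D (pmul p M).
Proof. by rewrite img_span2 !mul_mphi. Qed.

Lemma indep_pmul M p : mphi M \in unitmx -> indep p -> indep (pmul p M).
Proof.
move=> uM ip; apply: free_indep => x y; rewrite /= -!mul_mphi !scalemxAl -mulmxDl => e.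
by apply: (indep_free ip); rewrite -[LHS](mulmxK uM) e mul0mx.
Qed.

Lemma echelon_pmul M p : mphi M \in unitmx -> p \in echelons -> canon (pmul p M) \in echelons.
Proof. by move=> uM /(allP echelons_indep) ip; apply/canon_echelon/indep_pmul. Qed.

Lemma img_D_canon M p : mphi M \in unitmx -> p \in echelons ->
  img (mphi M) (D p) = D (canon (pmul p M)).
Proof. by move=> uM /(allP echelons_indep) ip; rewrite D_canon ?indep_pmul // img_D. Qed.

Lemma images_sub Ms p : (forall M, M \in Ms -> mphi M \in unitmx) -> p \in echelons ->
  {subset images Ms p <= echelons}.
Proof.
by move=> uMs pe q; rewrite mem_undup => /mapP[M MMs ->]; apply/echelon_pmul/pe/uMs.
Qed.

Lemma mem_add_orbits Ms o s os : o \in foldl (add_orbit Ms) os s ->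
  o \in os \/ exists2 p, p \in s & o = images Ms p.
Proof.
elim: s os => [|p s IH] os /=; first by left.
case/IH => [|[q qs ->]]; last by right; exists q; rewrite // inE qs orbT.
rewrite /add_orbit; case: ifP => _; first by left.
by rewrite inE => /orP[/eqP ->|]; [right; exists p; rewrite ?mem_head | left].
Qed.

Lemma mem_orbits Ms o : o \in orbits Ms -> exists2 p, p \in echelons & o = images Ms p.
Proof. by rewrite /orbits => h; have [|//] := mem_add_orbits h; rewrite in_nil. Qed.

(** * The critical subgroup *)

Lemma span2_scale (x : F) u w : x != 0 -> span2 (x *: u) (x *: w) = span2 u w :> {set 'rV[F]_4}.
Proof.
move=> x0; apply/setP => v; apply/mem_span2/mem_span2 => [[a [b ->]]|[a [b ->]]].
  by exists (a * x), (b * x); rewrite !scalerA.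
by exists (a / x), (b / x); rewrite !scalerA !mulfVK.
Qed.

Lemma img_scale (x : F) A p : x != 0 -> img (x *: A) (D p) = img A (D p).
Proof. by move=> x0; rewrite !img_span2 -!scalemxAr span2_scale. Qed.

Lemma imgM A B (L : {set 'rV[F]_4}) : img B (img A L) = img (A *m B) L.
Proof.
rewrite /img -imset_comp; apply: eq_imset => v /=; by rewrite mulmxA.
Qed.

(** Treats both groups at once. Inverses are required only up to a nonzero scalar, which is the form
    in which [Mabcd_adj] provides them; lines do not see the scalar. *)
Lemma orbit_eq (S : 'M[F]_4 -> Prop) (orb : {set 'rV[F]_4} -> {set {set 'rV[F]_4}}) :
  (forall L L', L' \in orb L <-> exists2 A, S A & L' = img A L) ->
  (forall A B, S A -> S B -> S (A *m B)) ->
  (forall A, S A -> exists B x, [/\ S B, x != 0 & A *m B = x%:M]) ->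
  forall L L', L \in lines F -> L' \in orb L -> orb L' = orb L.
Proof.
move=> orbP SM SV _ L' /linesP[p _ ->] /orbP[A SA ->].
apply/setP => L; apply/idP/idP => /orbP[B SB ->]; apply/orbP.
  by exists (A *m B); [apply: SM | rewrite imgM].
have [C [x [SC x0 AC]]] := SV _ SA; exists (C *m B); first exact: SM.
by rewrite imgM mulmxA AC mul_scalar_mx img_scale.
Qed.

(** [Mabcd] is a third symmetric power: it sends the cubic monomials in (t, 1) to those in (at + b,
    ct + d). Matrices act on row vectors from the right, so the 2x2 matrices multiply in the
    opposite order. *)
Lemma Mabcd_mul (R : finFieldType) (a b c d a' b' c' d' : R) :
  Mabcd a b c d *m Mabcd a' b' c' d' =
  Mabcd (a' * a + b' * c) (a' * b + b' * d) (c' * a + d' * c) (c' * b + d' * d).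
Proof.
apply/matrixP => i j; rewrite !mxE !big_ord_recl big_ord0 !mxE.
by case: i j => [[|[|[|[|i]]]] hi] [[|[|[|[|j]]]] hj] //=; ring.
Qed.

Lemma Mabcd_scalar (R : finFieldType) (a : R) : Mabcd a 0 0 a = (a ^+ 3)%:M.
Proof.
apply/matrixP => i j; rewrite !mxE.
by case: i j => [[|[|[|[|i]]]] hi] [[|[|[|[|j]]]] hj] //=; rewrite ?mulr1n ?mulr0n; ring.
Qed.

Lemma Mabcd_adj (R : finFieldType) (a b c d : R) :
  Mabcd a b c d *m Mabcd d (- b) (- c) a = ((a * d - b * c) ^+ 3)%:M.
Proof. by rewrite Mabcd_mul -Mabcd_scalar; congr Mabcd; ring. Qed.

Lemma orbSP (L L' : {set 'rV[F]_4}) : L' \in orbS L <->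
  exists2 A, exists a b c d, a * d - b * c != 0 /\ A = Mabcd a b c d & L' = img A L.
Proof.
rewrite inE; split.
  move=> /existsP[a /existsP[b /existsP[c /existsP[d /andP[h /eqP->]]]]].
  by exists (Mabcd a b c d) => //; exists a, b, c, d.
move=> [_ [a [b [c [d [h ->]]]]] ->]; apply/existsP; exists a; apply/existsP; exists b.
by apply/existsP; exists c; apply/existsP; exists d; rewrite h eqxx.
Qed.

Lemma orbS_eq (L L' : {set 'rV[F]_4}) : L \in lines F -> L' \in orbS L -> orbS L' = orbS L.
Proof.
move: L L'; apply: (orbit_eq orbSP).
  move=> _ _ [a [b [c [d [h ->]]]]] [a' [b' [c' [d' [h' ->]]]]].
  rewrite Mabcd_mul; do 4!eexists; split; last by [].
  have -> : (a' * a + b' * c) * (c' * b + d' * d) - (a' * b + b' * d) * (c' * a + d' * c) =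
    (a * d - b * c) * (a' * d' - b' * c') by ring.
  by rewrite mulf_neq0.
move=> _ [a [b [c [d [h ->]]]]].
exists (Mabcd d (- b) (- c) a), ((a * d - b * c) ^+ 3); split.
- exists d, (- b), (- c), a; split=> //.
  by rewrite mulrNN [d * a]mulrC.
- by rewrite expf_neq0.
- exact: Mabcd_adj.
Qed.

Lemma Gq_mul (A B : 'M[F]_4) : A \in Gq F -> B \in Gq F -> A *m B \in Gq F.
Proof.
rewrite !inE => /and3P[uA /forallP hA /forallP kA] /and3P[uB /forallP hB /forallP kB].
rewrite unitmx_mul uA uB /=; apply/andP; split; apply/forallP => t.
  have /existsP[s hs] := hA t; have /existsP[r hr] := hB s.
  apply/existsP; exists r; rewrite mulmxA.
  by apply/eqmxP; apply: eqmx_trans (eqmxMr B (eqmxP hs)) (eqmxP hr).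
have /existsP[s hs] := kB t; have /existsP[r hr] := kA s.
apply/existsP; exists r; rewrite mulmxA.
by apply/eqmxP; apply: eqmx_trans (eqmxMr B (eqmxP hr)) (eqmxP hs).
Qed.

(** Inversion exchanges the two conditions on points in the definition of [Gq]. *)
Lemma Gq_inv (A : 'M[F]_4) : A \in Gq F -> invmx A \in Gq F.
Proof.
rewrite !inE => /and3P[uA /forallP hA /forallP kA]; rewrite unitmx_inv uA /=.
apply/andP; split; apply/forallP => t.
  have /existsP[s /eqmxP hs] := kA t; apply/existsP; exists s; apply/eqmxP.
  apply: eqmx_trans (eqmxMr (invmx A) (eqmx_sym hs)) _.
  by rewrite mulmxK.
have /existsP[s /eqmxP hs] := hA t; apply/existsP; exists s; apply/eqmxP.
apply: eqmx_trans (eqmxMr (invmx A) (eqmx_sym hs)) _.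
by rewrite mulmxK.
Qed.

Lemma orbGP (L L' : {set 'rV[F]_4}) : L' \in orbG L <-> exists2 A, A \in Gq F & L' = img A L.
Proof. by split=> [/imsetP|h]; [|apply/imsetP]. Qed.

Lemma orbG_eq (L L' : {set 'rV[F]_4}) : L \in lines F -> L' \in orbG L -> orbG L' = orbG L.
Proof.
move: L L'; apply: (orbit_eq orbGP) => [A B|A GA]; first exact: Gq_mul.
exists (invmx A), 1; rewrite oner_neq0 mulmxV; first by split=> //; apply: Gq_inv.
by move: GA; rewrite inE => /andP[].
Qed.

Lemma three1 : 3%:R = 1 :> F.
Proof. by rewrite -addn1 natrD mulr2n two0 add0r. Qed.

Lemma mphi_critical a b c d :
  mphi (critical (a, b, c, d)) = Mabcd (phi a) (phi b) (phi c) (phi d).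
Proof.
apply/matrixP => i j; rewrite !mxE three1 mulr2n two0.
by case: i j => [[|[|[|[|i]]]] hi] [[|[|[|[|j]]]] hj] //=; rewrite !mxE /= !phiM; ring.
Qed.

(** By [Mabcd_adj] the matrix is a factor of a nonzero scalar matrix. *)
Lemma criticals_unit M : M \in criticals -> mphi M \in unitmx.
Proof.
move=> /mapP[[[[a b] c] d]]; rewrite mem_filter => /andP[h _] ->.
rewrite mphi_critical -phi_eq0 phiD !phiM in h *.
rewrite -[phi b * _]oppx in h.
set e := _ - _ in h.
have := unitmx1 F 4; rewrite -(unitmxZ _ (_ : e ^+ 3 \is a GRing.unit)).
  by rewrite scalemx1 -Mabcd_adj unitmx_mul => /andP[].
by rewrite unitfE expf_neq0.
Qed.

Lemma orbS_images p : p \in echelons -> orbS (D p) = DS (images criticals p).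
Proof.
move=> pe; apply/setP => L; apply/idP/DSP => [/orbSP[_ [a [b [c [d [h ->]]]]] ->]|[q]].
  have [a' Ea] := phi_surj a; have [b' Eb] := phi_surj b.
  have [c' Ec] := phi_surj c; have [d' Ed] := phi_surj d.
  have Mc : critical (a', b', c', d') \in criticals.
    apply: map_f; rewrite mem_filter mem_vecs andbT -phi_eq0 phiD !phiM -Ea -Eb -Ec -Ed.
    by rewrite -[b * c]oppx.
  exists (canon (pmul p (critical (a', b', c', d')))).
    rewrite mem_undup.
    exact: (map_f (fun M => canon (pmul p M))).
  by rewrite -img_D_canon // ?criticals_unit // mphi_critical Ea Eb Ec Ed.
rewrite mem_undup => /mapP[M Mc ->] ->; apply/orbSP.
exists (mphi M); last by rewrite img_D_canon // criticals_unit.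
move: Mc => /mapP[[[[a b] c] d]]; rewrite mem_filter => /andP[h _] ->.
exists (phi a), (phi b), (phi c), (phi d); rewrite mphi_critical; split=> //.
by rewrite oppx -!phiM -phiD phi_eq0.
Qed.

(** * The stabiliser of the twisted cubic *)

Lemma ophi_surj (t : option F) : exists s, t = omap phi s.
Proof.
case: t => [x|]; last by exists None.
by have [y ->] := phi_surj x; exists (Some y).
Qed.

Lemma mem_params t : t \in params.
Proof. by case: t => [x|] //; rewrite inE (map_f Some (mem_gf4s x)). Qed.

Lemma Pt_phi t : Pt (omap phi t) = vphi (mPt t).
Proof. by case: t => [x|]; rewrite /vphi /= /cpt ?phiM ?phi1 ?phi0 //; congr rv4; ring. Qed.

Lemma Osc_phi t : Osc (omap phi t) = vphi (mOsc t).
Proof.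
case: t => [x|]; rewrite /vphi /= ?/cosc ?phiM ?phi1 ?phi0 // three1 !mul1r !oppx.
by congr rv4; ring.
Qed.

Lemma TanDir_phi t : TanDir (omap phi t) = vphi (mTan t).
Proof.
case: t => [x|]; rewrite /vphi /= ?/ctan ?phiM ?phi1 ?phi0 // three1 mulr2n two0 mul1r mul0r.
by congr rv4; ring.
Qed.

Lemma mem_units c : (c \in units) = (c != g0).
Proof. by case: c => [[] []]. Qed.

Lemma proj_eqP u v : reflect (exists2 c, c != g0 & u = vscale c v) (proj_eq u v).
Proof.
apply: (iffP hasP) => [[c + /eqP]|[c c0 ->]].
  by rewrite mem_units => c0 ->; exists c.
by exists c; rewrite ?mem_units.
Qed.

Lemma eqmx_vphi u v : (vphi u == vphi v)%MS = proj_eq u v.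
Proof.
apply/idP/proj_eqP => [/andP[/sub_rVP[a Ea] /sub_rVP[b Eb]]|[c c0 ->]].
  have [c Ec] := phi_surj a; have [c0|c0] := eqVneq c g0; last first.
    by exists c => //; apply: vphi_inj; rewrite vphiZ -Ec.
  (* A zero scalar means that both vectors vanish, and then any nonzero scalar relates them. *)
  exists g1 => //; apply: vphi_inj; rewrite vphiZ phi1 scale1r Eb Ea Ec c0 phi0 scale0r.
  by rewrite scaler0.
by apply/eqmxP; rewrite vphiZ; apply: eqmx_scale; rewrite phi_eq0.
Qed.

Lemma mphi_mmul M N : mphi (mmul M N) = mphi M *m mphi N.
Proof.
case: M => [[[r0 r1] r2] r3]; apply/row_matrixP => i; rewrite row_mul !rowK mul_mphi.
by case: i => [[|[|[|[|i]]]] hi].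
Qed.

Definition idm : mat := ((g1, g0, g0, g0), (g0, g1, g0, g0), (g0, g0, g1, g0), (g0, g0, g0, g1)).

Lemma mphi1 : mphi idm = 1%:M.
Proof.
apply/matrixP => i j; rewrite !mxE.
by case: i j => [[|[|[|[|i]]]] hi] [[|[|[|[|j]]]] hj] //=; rewrite !mxE /= ?phi0 ?phi1.
Qed.

Lemma mphi_inj : injective mphi.
Proof.
case=> [[[r0 r1] r2] r3] [[[s0 s1] s2] s3] /row_matrixP e.
have h i : (i < 4)%N -> nth vec0 [:: r0; r1; r2; r3] i = nth vec0 [:: s0; s1; s2; s3] i.
  by move=> hi; apply: vphi_inj; have := e (inord i); rewrite !rowK inordK.
have /= -> := h 0%N isT; have /= -> := h 1%N isT.
by have /= -> := h 2%N isT; have /= -> := h 3%N isT.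
Qed.

Lemma mphi_surj A : exists M, A = mphi M.
Proof.
have [r0 E0] := vphi_surj (row (inord 0) A); have [r1 E1] := vphi_surj (row (inord 1) A).
have [r2 E2] := vphi_surj (row (inord 2) A); have [r3 E3] := vphi_surj (row (inord 3) A).
exists (r0, r1, r2, r3); apply/row_matrixP => i; rewrite rowK -[i]inord_val.
by case: i => [[|[|[|[|i]]]] hi] //=; rewrite inordK.
Qed.

Definition mbasis : mat := (mPt None, mPt (Some g0), mPt (Some g1), mPt (Some gw)).

Lemma basis_invK : mmul basis_inv mbasis = idm.
Proof. by []. Qed.

(** [preserves] contains no test of invertibility. It is automatic: every point of the cubic is
    reached, so the row space contains P(oo), P(0), P(1), P(w), which span everything. *)
Lemma preservesP M : (mphi M \in Gq F) = preserves M.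
Proof.
have E t s : (Pt (omap phi t) *m mphi M == Pt (omap phi s))%MS = proj_eq (vmul (mPt t) M) (mPt s).
  by rewrite !Pt_phi mul_mphi eqmx_vphi.
rewrite inE; apply/and3P/andP => [[_ /forallP h /forallP k]|[/allP h /allP k]].
  split; apply/allP => t _.
    have /existsP[s] := h (omap phi t); have [s' ->] := ophi_surj s.
    by rewrite E => hs; apply/hasP; exists s'; rewrite ?mem_params.
  have /existsP[s] := k (omap phi t); have [s' ->] := ophi_surj s.
  by rewrite E => hs; apply/hasP; exists s'; rewrite ?mem_params.
have k' s : exists t, (Pt (omap phi t) *m mphi M == Pt (omap phi s))%MS.
  by have /hasP[t _ ht] := k s (mem_params s); exists t; rewrite E.
split.
- rewrite -row_full_unit -sub1mx -mphi1 -basis_invK mphi_mmul.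
  apply: submx_trans (submxMl _ _) _; apply/row_subP => i; rewrite rowK.
  have sub s : (vphi (mPt s) <= mphi M)%MS.
    rewrite -Pt_phi; have [t /andP[_ ht]] := k' s.
    exact: submx_trans ht (submxMl _ _).
  case: i => [[|[|[|[|i]]]] hi] //; [exact: (sub None) | exact: (sub (Some g0)) |
    exact: (sub (Some g1)) | exact: (sub (Some gw))].
- apply/forallP => t; have [t' ->] := ophi_surj t.
  have /hasP[s _ hs] := h t' (etrans (mem_rev _ _) (mem_params t')).
  by apply/existsP; exists (omap phi s); rewrite E.
- apply/forallP => s; have [s' ->] := ophi_surj s.
  by have [t ht] := k' s'; apply/existsP; exists (omap phi t).
Qed.

Definition mscale (x : gf4) (M : mat) : mat :=
  let: (r0, r1, r2, r3) := M in (vscale x r0, vscale x r1, vscale x r2, vscale x r3).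

Lemma mphi_mscale x M : mphi (mscale x M) = phi x *: mphi M.
Proof.
case: M => [[[r0 r1] r2] r3]; apply/row_matrixP => i; rewrite linearZ /= !rowK.
by case: i => [[|[|[|[|i]]]] hi] //=; rewrite vphiZ.
Qed.

Lemma preserves_mscale x M : x != g0 -> preserves M -> preserves (mscale x M).
Proof.
move=> x0; rewrite -!preservesP !inE mphi_mscale -phi_eq0 in x0 *.
have h (u v : 'rV_4) : (u *m (phi x *: mphi M) == v)%MS = (u *m mphi M == v)%MS :> bool.
  have E := eqmx_scale (u *m mphi M) x0; rewrite -scalemxAr.
  by apply/eqmxP/eqmxP => e; [apply: eqmx_trans (eqmx_sym E) e | apply: eqmx_trans E e].
case/and3P=> uM /forallP hM /forallP kM; rewrite unitmxZ ?unitfE // uM /=.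
apply/andP; split; apply/forallP => t.
  by have /existsP[s hs] := hM t; apply/existsP; exists s; rewrite h.
by have /existsP[s hs] := kM t; apply/existsP; exists s; rewrite h.
Qed.

Lemma mem_projectivities M : M \in projectivities -> preserves M.
Proof. by rewrite mem_filter => /andP[]. Qed.

Lemma proj_eq_cone u s : proj_eq u (mPt s) -> u \in cone.
Proof.
case/proj_eqP => c c0 ->; apply: (allpairs_f (fun c s => vscale c (mPt s))).
  by rewrite mem_units.
exact: mem_params.
Qed.

Lemma preserves_projectivity M : preserves M ->
  exists2 c, c != g0 & mscale c M \in projectivities.
Proof.
move=> pM; have image t N : preserves N -> exists s, proj_eq (vmul (mPt t) N) (mPt s).
  case/andP=> /allP/(_ t) h _; have /hasP[s _ hs] := h (etrans (mem_rev _ _) (mem_params t)).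
  by exists s.
have [s0 /proj_eqP[c c0 Es0]] := image None M pM.
have iv0 : ginv c != g0 by rewrite -phi_eq0 phiV invr_eq0 phi_eq0.
exists (ginv c); first exact: iv0.
have := preserves_mscale iv0 pM.
have vm v : vmul v (mscale (ginv c) M) = vscale (ginv c) (vmul v M).
  by apply: vphi_inj; rewrite vphiZ -!mul_mphi mphi_mscale scalemxAr.
have E0 : vmul (mPt None) (mscale (ginv c) M) = mPt s0.
  rewrite vm Es0; apply: vphi_inj; rewrite !vphiZ scalerA phiV mulVf ?scale1r //.
  by rewrite phi_eq0.
move: (mscale (ginv c) M) E0 => N E0 pN.
(* [mmul mbasis N] lists the images of the four basis points; this is the frame from which [N] is
   found in the enumeration. *)
have EN : N = mmul basis_inv (mmul mbasis N).
  by apply: mphi_inj; rewrite !mphi_mmul mulmxA -mphi_mmul basis_invK mphi1 mul1mx.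
have co t : vmul (mPt t) N \in cone by have [s /proj_eq_cone] := image t N pN.
rewrite mem_filter pN EN; apply: map_f; rewrite mem_filter; apply/andP; split.
  have -> : fifth (mmul mbasis N) = (vmul (mPt (Some (gadd g1 gw))) N \in cone).
    congr (_ \in cone); apply: vphi_inj; rewrite !vphiD -!mul_mphi -!mulmxDl -!vphiD.
    by [].
  exact: co.
rewrite /mmul /mbasis E0.
do 2!(apply: (allpairs_f (fun x r => (x, r))); last exact: co).
apply: (allpairs_f (fun s r => (mPt s, r))); [exact: mem_params | exact: co].
Qed.

Lemma projectivities_unit M : M \in projectivities -> mphi M \in unitmx.
Proof. by move=> /mem_projectivities; rewrite -preservesP inE => /andP[]. Qed.

(** The scalar of [preserves_projectivity] has no effect on lines, so the listed matrices already
    produce the whole orbit. *)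
Lemma orbG_images p : p \in echelons -> orbG (D p) = DS (images projectivities p).
Proof.
move=> pe; apply/setP => L; apply/idP/DSP => [/orbGP[A GA ->]|[q]].
  have [M EM] := mphi_surj A; rewrite EM preservesP in GA *.
  have [c c0 cM] := preserves_projectivity GA.
  exists (canon (pmul p (mscale c M))).
    rewrite mem_undup; exact: (map_f (fun M => canon (pmul p M))).
  rewrite -(img_D_canon (projectivities_unit cM) pe) mphi_mscale img_scale; first by [].
  by rewrite phi_eq0.
rewrite mem_undup => /mapP[M Mp ->] ->; apply/orbGP.
exists (mphi M); first by rewrite preservesP mem_projectivities.
by rewrite (img_D_canon (projectivities_unit Mp) pe).
Qed.

(** * Line types *)

Lemma zerosP c c' : zeros_spec c c' -> zeros c c' \in echelons /\
  [set v | (v *m (vphi c)^T == 0) && (v *m (vphi c')^T == 0)] = D (zeros c c').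
Proof.
case/andP=> ze /allP h; split=> //; apply: eqD => v.
by rewrite inE !vphi_dot (eqP (h v (mem_vecs v))).
Qed.

Lemma card_params (P : pred (option F)) :
  #|[set t | P t]| = count (fun t => P (omap phi t)) params.
Proof.
have uo : uniq (map (omap phi) params).
  by rewrite map_inj_uniq // => -[x|] [y|] //= [/phi_inj ->].
have -> : #|[set t | P t]| = #|filter P (map (omap phi) params)|.
  apply: eq_card => t; rewrite inE mem_filter; have [s ->] := ophi_surj t.
  by rewrite map_f ?mem_params ?andbT.
by rewrite (card_uniqP (filter_uniq _ uo)) size_filter count_map.
Qed.

Lemma on_C_D p : #|on_C (D p)| = incidence p.
Proof. by rewrite card_params; apply: eq_count => t; rewrite /= Pt_phi mem_D. Qed.

Lemma sub_gplane p t :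
  (D p \subset gplane (omap phi t)) = (dot p.1 (mOsc t) == g0) && (dot p.2 (mOsc t) == g0).
Proof.
apply/subsetP/andP => [h|[/eqP h1 /eqP h2] v].
  have h' v : gmem p v -> dot v (mOsc t) == g0.
    by rewrite -mem_D => /h; rewrite inE Osc_phi vphi_dot.
  by split; apply: h'; [apply: gmem1 | apply: gmem2].
move=> /mem_span2[a [b ->]]; rewrite inE Osc_phi mulmxDl -!scalemxAl.
have /eqP -> : vphi p.1 *m (vphi (mOsc t))^T == 0 by rewrite vphi_dot h1.
have /eqP -> : vphi p.2 *m (vphi (mOsc t))^T == 0 by rewrite vphi_dot h2.
by rewrite !scaler0 addr0.
Qed.

Lemma nGamma_D p : nGamma (D p) = osculation p.
Proof. by rewrite /nGamma card_params; apply: eq_count => t; rewrite /= sub_gplane. Qed.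

Lemma sub_tangents : {subset tangents <= echelons}.
Proof. by apply/allP; vm_compute. Qed.

Lemma sub_chords : {subset chords <= echelons}.
Proof. by apply/allP; vm_compute. Qed.

Lemma sub_axes : {subset axes <= echelons}.
Proof. by apply/allP; vm_compute. Qed.

Lemma sub_ichords : {subset ichords <= echelons}.
Proof. by apply/allP; vm_compute. Qed.

Lemma sub_iaxes : {subset iaxes <= echelons}.
Proof. by apply/allP; vm_compute. Qed.

Lemma tangents_indep : all (fun t => indep (mPt t, mTan t)) params.
Proof. by vm_compute. Qed.

Lemma chords_indep : all (fun st => indep (mPt st.1, mPt st.2)) distinct_params.
Proof. by vm_compute. Qed.

Lemma axes_spec : all (fun st => zeros_spec (mOsc st.1) (mOsc st.2)) distinct_params.
Proof. by vm_compute. Qed.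

Lemma ichords_spec :
  all (fun pr => zeros_spec (ichord_eqs pr).1 (ichord_eqs pr).2) irreducibles.
Proof. by vm_compute. Qed.

Lemma iaxes_spec :
  all (fun pr => zeros_spec (iaxis_eqs pr).1 (iaxis_eqs pr).2) irreducibles.
Proof. by vm_compute. Qed.

Lemma mem_distinct s t : ((s, t) \in distinct_params) = (s != t).
Proof.
have st : (s, t) \in [seq (s, t) | s <- params, t <- params].
  by apply: allpairs_f; apply: mem_params.
by rewrite mem_filter st andbT.
Qed.

Lemma ophi_inj : injective (omap phi).
Proof. by case=> [x|] [y|] //= [/phi_inj ->]. Qed.

Lemma mem_DS_lines s L : {subset s <= echelons} -> L \in DS s -> L \in lines F.
Proof. by move=> se /DSP[p /se pe ->]; apply: mem_lines. Qed.

Lemma TrE : Tr F = DS tangents.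
Proof.
have E t : span2 (Pt (omap phi t)) (TanDir (omap phi t)) = D (canon (mPt t, mTan t)).
  rewrite Pt_phi TanDir_phi D_canon //; exact: (allP tangents_indep t (mem_params t)).
apply/setP => L; rewrite inE; apply/andP/idP => [[_ /existsP[t /eqP ->]]|LT].
  by have [s ->] := ophi_surj t; rewrite E; apply/DSP; eexists; first exact/map_f/mem_params.
split; first exact: mem_DS_lines sub_tangents LT.
have /DSP[p /mapP[t _ ->] ->] := LT.
by apply/existsP; exists (omap phi t); rewrite E.
Qed.

Lemma RCE : RC F = DS chords.
Proof.
have E s t : s != t ->
    span2 (Pt (omap phi s)) (Pt (omap phi t)) = D (canon (mPt s, mPt t)).
  rewrite -mem_distinct => st; rewrite !Pt_phi D_canon //; exact: (allP chords_indep _ st).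
apply/setP => L; rewrite inE.
apply/andP/idP => [[_ /existsP[s /existsP[t /andP[st /eqP ->]]]]|LT].
  have [s' Es] := ophi_surj s; have [t' Et] := ophi_surj t; rewrite {}Es {}Et in st *.
  rewrite (inj_eq ophi_inj) in st; rewrite E //; apply/DSP; eexists; last by [].
  rewrite mem_undup; apply: (map_f (fun st => canon (mPt st.1, mPt st.2)) (x := (s', t'))).
  by rewrite mem_distinct.
split; first exact: mem_DS_lines sub_chords LT.
have /DSP[p + ->] := LT; rewrite mem_undup => /mapP[[s t]]; rewrite mem_distinct => st ->.
apply/existsP; exists (omap phi s); apply/existsP; exists (omap phi t).
by rewrite E // (inj_eq ophi_inj) st eqxx.
Qed.

Lemma RAE : RA F = DS axes.
Proof.
have E s t : s != t ->
    gplane (omap phi s) :&: gplane (omap phi t) = D (zeros (mOsc s) (mOsc t)).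
  rewrite -mem_distinct => /(allP axes_spec)/zerosP[_ <-].
  by apply/setP => v; rewrite !inE !Osc_phi.
apply/setP => L; rewrite inE.
apply/andP/idP => [[_ /existsP[s /existsP[t /andP[st /eqP ->]]]]|LT].
  have [s' Es] := ophi_surj s; have [t' Et] := ophi_surj t; rewrite {}Es {}Et in st *.
  rewrite (inj_eq ophi_inj) in st; rewrite E //; apply/DSP; eexists; last by [].
  rewrite mem_undup; apply: (map_f (fun st => zeros (mOsc st.1) (mOsc st.2)) (x := (s', t'))).
  by rewrite mem_distinct.
split; first exact: mem_DS_lines sub_axes LT.
have /DSP[p + ->] := LT; rewrite mem_undup => /mapP[[s t]]; rewrite mem_distinct => st ->.
apply/existsP; exists (omap phi s); apply/existsP; exists (omap phi t).
by rewrite E // (inj_eq ophi_inj) st eqxx.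
Qed.

Lemma filter_echelons P : {subset [seq p <- echelons | P p] <= echelons}.
Proof. by move=> p; rewrite mem_filter => /andP[]. Qed.

Lemma linesetE (X : pred {set 'rV[F]_4}) (P : pred gens) :
  (forall p, p \in echelons -> X (D p) = P p) ->
  [set L in lines F | X L] = DS [seq p <- echelons | P p].
Proof.
move=> XP; apply: sub_linesE; first exact: filter_echelons.
  by apply/subsetP => L; rewrite inE => /andP[].
by move=> p pe; rewrite inE mem_lines // XP // mem_filter pe andbT.
Qed.

Lemma UGE : UG F = DS UG_list.
Proof.
apply: linesetE => p pe.
by rewrite /unisecant on_C_D nGamma_D TrE (mem_DS sub_tangents pe).
Qed.

Lemma UnGE : UnG F = DS UnG_list.
Proof. by apply: linesetE => p pe; rewrite /unisecant on_C_D nGamma_D. Qed.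

Lemma EGE : EG F = DS EG_list.
Proof. by apply: linesetE => p pe; rewrite /external on_C_D nGamma_D. Qed.

(** * Imaginary chords and axes *)

Section Extension.
Variables (K : finFieldType) (f : {rmorphism F -> K}).
Hypothesis cardK : #|K| = 16%N.

Definition emb (x : gf4) : K := f (phi x).

Lemma embD : {morph emb : x y / gadd x y >-> x + y}.
Proof. by move=> x y; rewrite /emb phiD rmorphD. Qed.

Lemma embM : {morph emb : x y / gmul x y >-> x * y}.
Proof. by move=> x y; rewrite /emb phiM rmorphM. Qed.

Lemma emb1 : emb g1 = 1. Proof. by rewrite /emb phi1 rmorph1. Qed.
Lemma emb0 : emb g0 = 0. Proof. by rewrite /emb phi0 rmorph0. Qed.

Lemma emb_eq0 x : (emb x == 0) = (x == g0).
Proof. by rewrite fmorph_eq0 phi_eq0. Qed.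

Lemma embV x : emb (ginv x) = (emb x)^-1.
Proof. by rewrite /emb phiV fmorphV. Qed.

Lemma addxxK (x : K) : x + x = 0.
Proof. by rewrite -[x]mulr1 -mulrDr -(rmorph1 f) -rmorphD two0 rmorph0 mulr0. Qed.

Lemma oppxK (x : K) : - x = x.
Proof. by apply/eqP; rewrite eq_sym -addr_eq0 addxxK. Qed.

Lemma sqrDK (x y : K) : (x + y) ^+ 2 = x ^+ 2 + y ^+ 2.
Proof. by rewrite sqrrD mulr2n addxxK addr0. Qed.

Lemma notinFP a : reflect (forall x : gf4, a != emb x) (notinF f a).
Proof.
apply: (iffP idP) => [h x|h].
  by apply: contra h => /eqP ->; apply/existsP; exists (phi x).
by apply/negP => /existsP[b]; have [x ->] := phi_surj b; rewrite (negPf (h x)).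
Qed.

(** The product of s + x over the four x in F is s^4 + s: pairing the factors and writing u = s^2 +
    s turns it into u (u + 1) = u^2 + u. *)
Lemma fixed_in_F s : s ^+ 4 = s -> exists x, s = emb x.
Proof.
move=> s4; suff /eqP : s * (s + emb g1) * (s + emb gw) * (s + emb (gadd g1 gw)) = 0.
  rewrite !mulf_eq0 => /orP[/orP[/orP[/eqP e|]|]|].
  - by exists g0; rewrite emb0.
  - by rewrite addr_eq0 oppxK => /eqP ->; exists g1.
  - by rewrite addr_eq0 oppxK => /eqP ->; exists gw.
  - by rewrite addr_eq0 oppxK => /eqP ->; exists (gadd g1 gw).
have ew : emb gw = f th by rewrite /emb /phi /= mul1r add0r.
rewrite embD emb1 ew.
have t2 : f th ^+ 2 = f th + 1 by rewrite -rmorphXn thE rmorphD rmorph1.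
have -> : s * (s + 1) * (s + f th) * (s + (1 + f th)) =
   (s ^+ 2 + s) * (s ^+ 2 + s + (f th ^+ 2 + f th) + (s * f th + s * f th)) by ring.
rewrite t2 addxxK addr0 [_ + 1 + _]addrAC addxxK add0r.
have -> : (s ^+ 2 + s) * (s ^+ 2 + s + 1) = (s ^+ 2 + s) ^+ 2 + (s ^+ 2 + s) by ring.
by rewrite sqrDK -exprM s4 [s + _]addrC addxxK.
Qed.

(** Trace and norm over F, the conjugate of [a] being [a ^+ 4]. For [a] outside F these are the
    coefficients of its minimal polynomial. *)
Definition minpoly (a : K) (pr : gf4 * gf4) : Prop :=
  a + a ^+ 4 = emb pr.1 /\ a * a ^+ 4 = emb pr.2.

Lemma minpoly_eq a pr : minpoly a pr -> a ^+ 2 = emb pr.1 * a + emb pr.2.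
Proof. by case=> <- <-; rewrite -[LHS]addr0 -(addxxK (a * a ^+ 4)); ring. Qed.

Lemma minpoly_eq_conj a pr : minpoly a pr -> (a ^+ 4) ^+ 2 = emb pr.1 * a ^+ 4 + emb pr.2.
Proof. by case=> <- <-; rewrite -[LHS]addr0 -(addxxK (a * a ^+ 4)); ring. Qed.

(** Since a^16 = a, trace and norm are fixed by the fourth power and so lie in F. A root x in F
    would split the polynomial as (X + x)(X + x + p) and put [a] in F. *)
Lemma minpoly_ex a : notinF f a -> exists2 pr, pr \in irreducibles & minpoly a pr.
Proof.
move=> /notinFP aF.
have a16 : a ^+ 4 ^+ 4 = a by rewrite -exprM -[RHS]expf_card cardK.
have [p Ep] : exists x, a + a ^+ 4 = emb x.
  apply: fixed_in_F.
  by rewrite (exprM _ 2 2) !sqrDK -!exprM [(a ^+ (4 * 4))]exprM a16 addrC.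
have [r Er] : exists x, a * a ^+ 4 = emb x.
  by apply: fixed_in_F; rewrite exprMn a16 mulrC.
have m : minpoly a (p, r) by [].
exists (p, r) => //; rewrite mem_filter; apply/andP; split; last first.
  exact: (allpairs_f (fun p r => (p, r)) (mem_gf4s p) (mem_gf4s r)).
apply/allP => x _; apply/negP; rewrite -emb_eq0 !(embD, embM) => /eqP e.
have : (a + emb x) * (a + emb (gadd x p)) == 0.
  rewrite embD; have -> : (a + emb x) * (a + (emb x + emb p)) =
    (a ^+ 2 + (emb p * a + emb r)) + (emb x * emb x + emb p * emb x + emb r) +
    (a * emb x + a * emb x) - (emb r + emb r) by ring.
  by rewrite e (minpoly_eq m) !addxxK oppr0 !addr0.
rewrite mulf_eq0 !addr_eq0 !oppxK => /orP[] /eqP h; first by have := aF x; rewrite h eqxx.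
by have := aF (gadd x p); rewrite h eqxx.
Qed.

Lemma notinF_ex : exists a, notinF f a.
Proof.
have [/existsP //|/existsPn h] := boolP [exists a, notinF f a].
suff : (#|K| <= #|F|)%N by rewrite cardK cardF.
have -> : #|K| = #|f @: F|; last exact: leq_imset_card.
apply: eq_card => y; have := h y; rewrite negbK => /existsP[x /eqP ->].
by rewrite imset_f.
Qed.

(* If c is a root of X^2 + pX + r for pr = (p, r), then a + b c is a root of the
   polynomial given in the same way by qs. *)
Definition substitutions : bool :=
  all (fun pr => all (fun qs => has (fun ab => let: (a, b) := ab in
      [&& b != g0, gmul (gmul b b) pr.1 == gmul qs.1 b &
          gadd (gmul a a) (gmul (gmul b b) pr.2) == gadd (gmul qs.1 a) qs.2])
    [seq (a, b) | a <- gf4s, b <- gf4s]) irreducibles) irreducibles.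

Lemma substitutionsT : substitutions.
Proof. by vm_compute. Qed.

(** Counting supplies only one element c outside F. The substitutions a + b c over F turn it into a
    root of any prescribed irreducible polynomial. *)
Lemma minpoly_onto qs : qs \in irreducibles -> exists2 a, notinF f a & minpoly a qs.
Proof.
move=> hqs; have [c cF] := notinF_ex; have [pr hpr mc] := minpoly_ex cF.
have /hasP[[a b] _ /and3P[b0 /eqP/(congr1 emb) e1 /eqP/(congr1 emb) e2]] :=
  allP (allP substitutionsT _ hpr) _ hqs.
rewrite !(embD, embM) in e1 e2.
have xF : notinF f (emb a + emb b * c).
  apply/notinFP => x; apply/eqP => e; have /notinFP/(_ (gmul (gadd x a) (ginv b))) := cF.
  rewrite embM embD embV -e -emb_eq0 in b0 *.
  rewrite [_ + emb a]addrAC addxxK add0r mulrAC mulfV // mul1r eqxx //.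
have [x Ex] : exists x, x = emb a + emb b * c by exists (emb a + emb b * c).
rewrite -Ex in xF; exists x => //.
have [[p' r'] hp' mx] := minpoly_ex xF.
have E : x ^+ 2 = emb qs.1 * x + emb qs.2.
  rewrite [in LHS]Ex sqrDK exprMn (minpoly_eq mc).
  have -> : emb a ^+ 2 + emb b ^+ 2 * (emb pr.1 * c + emb pr.2) =
    (emb a * emb a + emb b * emb b * emb pr.2) + (emb b * emb b * emb pr.1) * c by ring.
  by rewrite e1 e2 Ex; ring.
(* Two monic quadratics over F vanish at x. Their difference is a linear relation over F, which must
   be trivial because x is outside F; so [qs] is the minimal polynomial. *)
have E' : emb (gadd qs.1 p') * x = emb (gadd qs.2 r').
  apply/eqP; rewrite -subr_eq0 oppxK !embD.
  have -> : (emb qs.1 + emb p') * x + (emb qs.2 + emb r') =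
     (emb qs.1 * x + emb qs.2) + (emb p' * x + emb r') by ring.
  by rewrite -E -(minpoly_eq mx) addxxK.
have [q0|q0] := eqVneq (gadd qs.1 p') g0; last first.
  have /notinFP/(_ (gmul (ginv (gadd qs.1 p')) (gadd qs.2 r'))) := xF.
  by rewrite embM -E' embV mulKf ?emb_eq0 // eqxx.
move: E'; rewrite q0 emb0 mul0r => /esym/eqP; rewrite emb_eq0 gadd_eq0 => /eqP e'.
move/eqP: q0; rewrite gadd_eq0 => /eqP q0.
by case: qs q0 e' {hqs e1 e2 E} => /= p r -> ->.
Qed.

Lemma map_vphi u : map_mx f (vphi u) =
  rv4 (emb (co 0 u)) (emb (co 1 u)) (emb (co 2 u)) (emb (co 3 u)).
Proof.
case: u => [[[a b] c] d]; apply/rowP => i; rewrite !mxE.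
by case: i => [[|[|[|[|i]]]] hi].
Qed.

Lemma notinF_conj a : notinF f a -> a + a ^+ 4 != 0.
Proof.
move=> /notinFP aF; rewrite addr_eq0 oppxK; apply/eqP => /esym/fixed_in_F[x ax].
by have := aF x; rewrite ax eqxx.
Qed.

(** The two equations express the recurrences c^3 = p c^2 + r c and c^2 = p c + r, shared by [a] and
    its conjugate. Conversely, the last two coordinates determine the combination of the two points,
    and the recurrences return the first two. *)
Lemma ichord_set a pr : notinF f a -> minpoly a pr -> pr \in irreducibles ->
  [set v : 'rV[F]_4 | (map_mx f v <= col_mx (cpt a) (cpt (a ^+ #|F|)))%MS] =
  D (zeros (ichord_eqs pr).1 (ichord_eqs pr).2).
Proof.
move=> aF m hpr; have [_ <-] := zerosP (allP ichords_spec _ hpr).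
apply/setP => v; have [u ->] := vphi_surj v; rewrite !inE !vphi_dot cardF -!emb_eq0.
have -> : (map_mx f (vphi u) <= col_mx (cpt a) (cpt (a ^+ 4)))%MS =
  (map_mx f (vphi u) \in span2 (cpt a) (cpt (a ^+ 4))) by rewrite inE.
have b0 := notinF_conj aF.
have ma := minpoly_eq m; have mb := minpoly_eq_conj m.
rewrite map_vphi; case: u => [[[y0 y1] y2] y3]; case: pr m hpr ma mb => p r m _ /=.
move: (a ^+ 4) b0 => b b0 ma mb.
rewrite !(embD, embM, emb0, emb1) !mulr1 !mulr0 !addr0 !add0r.
have a3 : a ^+ 3 = emb p * a ^+ 2 + emb r * a by rewrite exprS [in LHS]ma; ring.
have b3 : b ^+ 3 = emb p * b ^+ 2 + emb r * b by rewrite exprS [in LHS]mb; ring.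
apply/mem_span2/andP => [[x [y]]|[/eqP e1 /eqP e2]].
  rewrite /cpt !rv4Z rv4D => /rv4_inj[-> -> -> ->].
  split; apply/eqP.
    rewrite a3 b3 -[RHS](addxxK (x * (emb p * a ^+ 2 + emb r * a) +
                                y * (emb p * b ^+ 2 + emb r * b))).
    by ring.
  rewrite ma mb -[RHS](addxxK (x * (emb p * a + emb r) + y * (emb p * b + emb r))).
  by ring.
(* Cramer's rule for x + y = y3 and x a + y b = y2, with determinant a + b, nonzero because [a]
   differs from its conjugate. *)
set x := (emb y2 + b * emb y3) / (a + b); set y := (emb y2 + a * emb y3) / (a + b).
have h3 : emb y3 = x + y.
  have -> : x + y = emb y3 + (emb y2 + emb y2) / (a + b) by rewrite /x /y; field.
  by rewrite addxxK mul0r addr0.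
have h2 : emb y2 = x * a + y * b.
  have -> : x * a + y * b = emb y2 + (a * b * emb y3 + a * b * emb y3) / (a + b).
    by rewrite /x /y; field.
  by rewrite addxxK mul0r addr0.
have h1 : emb y1 = x * a ^+ 2 + y * b ^+ 2.
  rewrite -[LHS]oppxK; move: e2 => /eqP; rewrite addr_eq0 => /eqP ->.
  by rewrite opprK h2 h3 ma mb; ring.
have h0 : emb y0 = x * a ^+ 3 + y * b ^+ 3.
  rewrite -[LHS]oppxK; move: e1 => /eqP; rewrite -addrA addr_eq0 => /eqP ->.
  by rewrite opprK h2 h1 a3 b3; ring.
by exists x, y; rewrite /cpt !rv4Z rv4D !mulr1 -h0 -h1 -h2 -h3.
Qed.

(** Modulo the minimal polynomial, the equation of the plane at a root c becomes A + c B = 0 with A,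
    B from F. If it holds at both roots then (a + b) B = 0, so B and A vanish. *)
Lemma iaxis_set a pr : notinF f a -> minpoly a pr -> pr \in irreducibles ->
  [set v : 'rV[F]_4 | (map_mx f v *m (cosc a)^T == 0) &&
                      (map_mx f v *m (cosc (a ^+ #|F|))^T == 0)] =
  D (zeros (iaxis_eqs pr).1 (iaxis_eqs pr).2).
Proof.
move=> aF m hpr; have [_ <-] := zerosP (allP iaxes_spec _ hpr).
apply/setP => v; have [u ->] := vphi_surj v; rewrite !inE !vphi_dot cardF -!emb_eq0.
have b0 := notinF_conj aF.
have ma := minpoly_eq m; have mb := minpoly_eq_conj m.
have three1K : 3%:R = 1 :> K by rewrite -(rmorph_nat f) three1 rmorph1.
rewrite map_vphi /cosc three1K !mul1r !oppxK !rv4_mul_tr.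
case: u => [[[y0 y1] y2] y3]; case: pr m hpr ma mb => p r m _ /=.
move: (a ^+ 4) b0 => b b0 ma mb.
rewrite !(embD, embM, emb0, emb1) !mulr1 !mulr0 !addr0 !add0r.
set A := emb y0 + (_ + _); set B := emb y1 + (_ + _).
have E c : c ^+ 2 = emb p * c + emb r ->
    emb y0 + emb y1 * c + (emb y2 * c ^+ 2 + emb y3 * c ^+ 3) = A + c * B.
  move=> mc; have c3 : c ^+ 3 = emb p * c ^+ 2 + emb r * c by rewrite exprS [in LHS]mc; ring.
  by rewrite c3 mc /A /B; ring.
rewrite (E a ma) (E b mb); apply/andP/andP => [[/eqP ea /eqP eb]|[/eqP -> /eqP ->]]; last first.
  by rewrite !mulr0 addr0.
have B0 : B = 0.
  have /eqP : (a + b) * B = 0.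
    have -> : (a + b) * B = (A + a * B) + (A + b * B) - (A + A) by ring.
    by rewrite ea eb (addxxK A) subr0 addr0.
  by rewrite mulf_eq0 (negPf b0) => /eqP.
by move: ea; rewrite B0 mulr0 addr0 => ->.
Qed.

Lemma ICE : IC f = DS ichords.
Proof.
apply/setP => L; rewrite inE; apply/andP/idP => [[_ /existsP[a /andP[aF /eqP ->]]]|LI].
  have [pr hpr m] := minpoly_ex aF; rewrite (ichord_set aF m hpr).
  apply/DSP; eexists; last by [].
  exact: (map_f (fun pr => zeros (ichord_eqs pr).1 (ichord_eqs pr).2) hpr).
split; first exact: mem_DS_lines sub_ichords LI.
have /DSP[_ /mapP[pr hpr ->] ->] := LI; have [a aF m] := minpoly_onto hpr.
by apply/existsP; exists a; rewrite aF (ichord_set aF m hpr) eqxx.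
Qed.

Lemma IAE : IA f = DS iaxes.
Proof.
apply/setP => L; rewrite inE; apply/andP/idP => [[_ /existsP[a /andP[aF /eqP ->]]]|LI].
  have [pr hpr m] := minpoly_ex aF; rewrite (iaxis_set aF m hpr).
  apply/DSP; eexists; last by [].
  exact: (map_f (fun pr => zeros (iaxis_eqs pr).1 (iaxis_eqs pr).2) hpr).
split; first exact: mem_DS_lines sub_iaxes LI.
have /DSP[_ /mapP[pr hpr ->] ->] := LI; have [a aF m] := minpoly_onto hpr.
by apply/existsP; exists a; rewrite aF (iaxis_set aF m hpr) eqxx.
Qed.

Lemma EnGE : EnG f = DS EnG_list.
Proof.
apply: linesetE => p pe; rewrite /external on_C_D nGamma_D.
have -> : (D p \in IC f) = (p \in ichords) by rewrite ICE; exact: mem_DS sub_ichords pe.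
have -> : (D p \in IA f) = (p \in iaxes) by rewrite IAE; exact: mem_DS sub_iaxes pe.
exact: erefl.
Qed.

(** * Orbits *)

Opaque echelons projectivities criticals orbitsG orbitsS.

(** For an echelon form the default [[::]] is never reached in the two tables, by [cover_orbitsG]
    and [cover_orbitsS]. *)
Definition lookup (os : seq (seq gens)) (p : gens) : seq gens :=
  nth [::] os (find (fun o : seq gens => p \in o) os).
Definition same (s t : seq gens) : bool := all (mem t) s && all (mem s) t.
Definition isorb (s : seq gens) : bool := has (same s) orbitsG.

Lemma sameP s t : reflect (s =i t) (same s t).
Proof.
apply: (iffP andP) => [[/allP st /allP ts] p|e].
  by apply/idP/idP => [/st|/ts].
by split; apply/allP => p; rewrite /= e.
Qed.

Lemma cover_orbitsG : all (fun p => has (fun o : seq gens => p \in o) orbitsG) echelons.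
Proof. by vm_compute. Qed.

Lemma cover_orbitsS : all (fun p => has (fun o : seq gens => p \in o) orbitsS) echelons.
Proof. by vm_compute. Qed.

Lemma sub_orbitsG o : o \in orbitsG -> {subset o <= echelons}.
Proof.
rewrite orbitsGE => /mem_orbits[p pe ->].
by apply: images_sub pe => M /projectivities_unit.
Qed.

Lemma sub_orbitsS o : o \in orbitsS -> {subset o <= echelons}.
Proof.
rewrite orbitsSE => /mem_orbits[p pe ->].
by apply: images_sub pe => M /criticals_unit.
Qed.

Lemma uniq_orbitsS o : o \in orbitsS -> uniq o.
Proof. by rewrite orbitsSE => /mem_orbits[q _ ->]; apply: undup_uniq. Qed.

Lemma orbG_DS o p : o \in orbitsG -> p \in o -> orbG (D p) = DS o.
Proof.
rewrite orbitsGE => /mem_orbits[q qe ->] pq.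
rewrite -(orbG_images qe); apply: orbG_eq; first exact: mem_lines.
by rewrite (orbG_images qe); apply/DSP; exists p.
Qed.

Lemma orbS_DS o p : o \in orbitsS -> p \in o -> orbS (D p) = DS o.
Proof.
rewrite orbitsSE => /mem_orbits[q qe ->] pq.
rewrite -(orbS_images qe); apply: orbS_eq; first exact: mem_lines.
by rewrite (orbS_images qe); apply/DSP; exists p.
Qed.

Lemma lookupP os p : has (fun o : seq gens => p \in o) os ->
  lookup os p \in os /\ p \in lookup os p.
Proof. by move=> h; split; [apply: mem_nth; rewrite -has_find | exact: nth_find h]. Qed.

Lemma orbG_lookup p : p \in echelons ->
  lookup orbitsG p \in orbitsG /\ orbG (D p) = DS (lookup orbitsG p).
Proof. by move=> /(allP cover_orbitsG)/lookupP[lo pl]; split; last exact: orbG_DS. Qed.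

Lemma orbS_lookup p : p \in echelons ->
  lookup orbitsS p \in orbitsS /\ orbS (D p) = DS (lookup orbitsS p).
Proof. by move=> /(allP cover_orbitsS)/lookupP[lo pl]; split; last exact: orbS_DS. Qed.

Lemma card_orbS p : p \in echelons -> #|orbS (D p)| = size (lookup orbitsS p).
Proof.
move=> /orbS_lookup[lo ->].
by rewrite card_DS //; [exact: uniq_orbitsS | exact: sub_orbitsS].
Qed.

Lemma nonempty_orbitsG : [::] \notin orbitsG.
Proof. by vm_compute. Qed.

(** The table contains the orbit of every line, and each of its entries, being nonempty, is the
    orbit of its head. Being an orbit thus becomes a finite search. *)
Lemma isGorbit_DS s : {subset s <= echelons} -> isGorbit (DS s) = isorb s.
Proof.
move=> se; apply/existsP/hasP => [[L /andP[/linesP[p pe ->] /eqP]]|[o oG /sameP so]].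
  have [lo ->] := orbG_lookup pe => e; exists (lookup orbitsG p); first exact: lo.
  by apply/sameP; apply: DS_inj e; [exact: se | exact: sub_orbitsG lo].
case: o oG so => [|p o] oG so; first by have := negP nonempty_orbitsG oG.
exists (D p); rewrite mem_lines ?(sub_orbitsG oG) ?mem_head //=.
by rewrite (orbG_DS oG) ?mem_head // (eq_DS so).
Qed.

Definition DSS (os : seq (seq gens)) : {set {set {set 'rV[F]_4}}} := [set O in map DS os].

Lemma DSSP os O : reflect (exists2 o, o \in os & O = DS o) (O \in DSS os).
Proof. by rewrite inE; apply: mapP. Qed.

(** Distinctness is tested by [same] because lists in different order may describe one set of
    lines. *)
Lemma card_DSS (os : seq (seq gens)) : (forall o, o \in os -> {subset o <= echelons}) ->
  pairwise (fun o o' => ~~ same o o') os -> #|DSS os| = size os.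
Proof.
move=> se pw; rewrite cardsE; have /card_uniqP -> : uniq (map DS os); last by rewrite size_map.
elim: os se pw => //= o os IH se /andP[/allP ho pw]; rewrite IH //; last first.
  by move=> o' o'os; apply: se; rewrite inE o'os orbT.
rewrite andbT; apply/mapP => -[o' o'os e]; apply: (negP (ho o' o'os)); apply/sameP.
by apply: DS_inj e; apply: se; rewrite inE ?eqxx ?o'os ?orbT.
Qed.

Lemma orbG_set : [set orbG L | L in lines F] = DSS orbitsG.
Proof.
apply/setP => O; apply/imsetP/DSSP => [[L /linesP[p pe ->] ->]|[o oG ->]].
  by have [lo ->] := orbG_lookup pe; exists (lookup orbitsG p).
case: o oG => [|p o] oG; first by have := negP nonempty_orbitsG oG.
exists (D p); first by rewrite mem_lines // (sub_orbitsG oG) // mem_head.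
by rewrite (orbG_DS oG) // mem_head.
Qed.

(** [has] matches the sets of the statement, which collect the orbits of single En-Gamma lines; that
    an orbit meets the class is all that is asked. *)
Definition orbitsS_size (n : nat) : seq (seq gens) :=
  [seq o <- orbitsS | (size o == n) && has (mem EnG_list) o].

Lemma sub_EnG_list : {subset EnG_list <= echelons}.
Proof. by move=> p; rewrite mem_filter => /andP[]. Qed.

Lemma orbS_set n : [set orbS L | L in [set L in EnG f | #|orbS L| == n]] = DSS (orbitsS_size n).
Proof.
apply/setP => O; apply/imsetP/DSSP => [[L]|[o]].
  rewrite inE EnGE => /andP[/DSP[p pn ->] cp ->]; have pe := sub_EnG_list pn.
  have [lo E] := orbS_lookup pe; exists (lookup orbitsS p); last exact: E.
  rewrite mem_filter lo andbT -(card_orbS pe) cp; apply/hasP; exists p; last exact: pn.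
  by have [_ ->] := lookupP (allP cover_orbitsS p pe).
rewrite mem_filter => /andP[/andP[/eqP so /hasP[p po pn]] oS ->]; have pe := sub_EnG_list pn.
exists (D p); last by rewrite (orbS_DS oS po).
rewrite inE EnGE (orbS_DS oS po) (card_DS (uniq_orbitsS oS) (sub_orbitsS oS)) so eqxx andbT.
apply/DSP; exists p; [exact: pn | exact: erefl].
Qed.

Lemma Gorbit_DSS (os : seq (seq gens)) : (forall o, o \in os -> {subset o <= echelons}) ->
  [set O in DSS os | isGorbit O] = DSS [seq o <- os | isorb o].
Proof.
move=> se; apply/setP => O; rewrite inE; apply/andP/DSSP => [[/DSSP[o oos ->]]|[o]].
  rewrite (isGorbit_DS (se _ oos)) => io; exists o => //.
  by rewrite mem_filter io.
rewrite mem_filter => /andP[io oos] ->; rewrite (isGorbit_DS (se _ oos)) io.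
by split=> //; apply/DSSP; exists o.
Qed.

Lemma bigcup_DSS (os : seq (seq gens)) : (forall o, o \in os -> {subset o <= echelons}) ->
  \bigcup_(O in DSS os | ~~ isGorbit O) O = DS (flatten [seq o <- os | ~~ isorb o]).
Proof.
move=> se; apply/setP => L; apply/bigcupP/DSP => [[O /andP[/DSSP[o oos ->]]]|[p]].
  rewrite (isGorbit_DS (se _ oos)) => io /DSP[p po ->]; exists p => //.
  by apply/flattenP; exists o; rewrite ?mem_filter ?io.
case/flattenP => o; rewrite mem_filter => /andP[io oos] po ->.
exists (DS o); last by apply/DSP; exists p.
by rewrite (isGorbit_DS (se _ oos)) io andbT; apply/DSSP; exists o.
Qed.

Lemma Gorbit_lines (X : {set {set 'rV[F]_4}}) s : X = DS s -> {subset s <= echelons} ->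
  isorb s -> uniq s -> isGorbit X /\ #|X| = size s.
Proof. by move=> -> se io us; rewrite isGorbit_DS // card_DS. Qed.

Lemma card_Gorbits : #|[set orbG L | L in lines F]| = 12%N.
Proof.
rewrite orbG_set card_DSS; first by vm_compute.
  exact: sub_orbitsG.
by vm_compute.
Qed.

(** * The line types compared with the orbit tables *)

Lemma RC_Gorbit : isGorbit (RC F) /\ #|RC F| = 10%N.
Proof. by apply: (Gorbit_lines RCE sub_chords); vm_compute. Qed.

Lemma RA_Gorbit : isGorbit (RA F) /\ #|RA F| = 10%N.
Proof. by apply: (Gorbit_lines RAE sub_axes); vm_compute. Qed.

Lemma UnG_Gorbit : isGorbit (UnG F) /\ #|UnG F| = 60%N.
Proof.
have [||i c] := Gorbit_lines UnGE (@filter_echelons _); [by vm_compute | by vm_compute |].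
by rewrite i c; split=> //; vm_compute.
Qed.

Lemma EG_Gorbit : isGorbit (EG F) /\ #|EG F| = 60%N.
Proof.
have [||i c] := Gorbit_lines EGE (@filter_echelons _); [by vm_compute | by vm_compute |].
by rewrite i c; split=> //; vm_compute.
Qed.

Lemma imaginary_Gorbit : isGorbit (IC f :|: IA f) /\ #|IC f :|: IA f| = 12%N.
Proof.
have E : IC f :|: IA f = DS (ichords ++ iaxes) by rewrite DS_cat ICE IAE.
have se : {subset ichords ++ iaxes <= echelons}.
  by move=> p; rewrite mem_cat => /orP[/sub_ichords|/sub_iaxes].
by have [||i c] := Gorbit_lines E se; [vm_compute | vm_compute | rewrite i c].
Qed.

Lemma sub_UG_list : {subset UG_list <= echelons}.
Proof. exact: filter_echelons. Qed.

Lemma UG_list_ex15 : has (fun p => size (lookup orbitsS p) == 15%N) UG_list.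
Proof. by vm_compute. Qed.

Lemma UG_list_ex5 : has (fun p => size (lookup orbitsS p) == 5%N) UG_list.
Proof. by vm_compute. Qed.

Lemma UG_list15 : all (fun p => (size (lookup orbitsS p) == 15%N) ==>
  same (lookup orbitsG p) (lookup orbitsS p)) UG_list.
Proof. by vm_compute. Qed.

Lemma UG_list5 : all (fun p => (size (lookup orbitsS p) == 5%N) ==>
  let s := tangents ++ lookup orbitsS p in
  [&& same (lookup orbitsG p) s, uniq s & size s == 10%N]) UG_list.
Proof. by vm_compute. Qed.

Lemma UG_ex n : has (fun p => size (lookup orbitsS p) == n) UG_list ->
  exists2 L, L \in UG F & #|orbS L| = n.
Proof.
move=> /hasP[p pu /eqP <-]; exists (D p); last exact/card_orbS/sub_UG_list.
rewrite UGE; apply/DSP; exists p; [exact: pu | exact: erefl].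
Qed.

Lemma UG15 L : L \in UG F -> #|orbS L| = 15%N -> orbG L = orbS L.
Proof.
rewrite UGE => /DSP[p pu ->]; have pe := sub_UG_list pu; rewrite (card_orbS pe) => h.
have /implyP/(_ (introT eqP h))/sameP e := allP UG_list15 p pu.
by have [_ ->] := orbG_lookup pe; have [_ ->] := orbS_lookup pe; apply: eq_DS.
Qed.

Lemma UG5 L : L \in UG F -> #|orbS L| = 5%N ->
  orbG L = Tr F :|: orbS L /\ #|Tr F :|: orbS L| = 10%N.
Proof.
rewrite UGE => /DSP[p pu ->]; have pe := sub_UG_list pu; rewrite (card_orbS pe) => h.
have /implyP/(_ (introT eqP h))/and3P[/sameP e us /eqP sz] := allP UG_list5 p pu.
have [_ ->] := orbG_lookup pe; have [lo ->] := orbS_lookup pe.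
rewrite TrE -DS_cat (eq_DS e); split=> //.
rewrite (card_DS us) => [|q]; first exact: sz.
by rewrite mem_cat => /orP[/sub_tangents|/(sub_orbitsS lo)].
Qed.

Lemma sub_orbitsS_size n o : o \in orbitsS_size n -> {subset o <= echelons}.
Proof. by rewrite mem_filter => /andP[_]; apply: sub_orbitsS. Qed.

(** Serves sizes 20 and 30 alike: the hypotheses are closed computations on the tables, and [uniq s]
    also ensures that the merging orbits are disjoint, so that their sizes add up. *)
Lemma EnG_orbits n k m N :
  let os := orbitsS_size n in let s := flatten [seq o <- os | ~~ isorb o] in
  pairwise (fun o o' => ~~ same o o') os -> size os = k ->
  size [seq o <- os | isorb o] = m -> isorb s -> uniq s -> size s = N ->
  let S := [set orbS L | L in [set L in EnG f | #|orbS L| == n]] in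
  [/\ #|S| = k, #|[set O in S | isGorbit O]| = m,
      isGorbit (\bigcup_(O in S | ~~ isGorbit O) O) &
      #|\bigcup_(O in S | ~~ isGorbit O) O| = N].
Proof.
move=> os s pw <- <- io us <- S; rewrite {}/S orbS_set.
have se := @sub_orbitsS_size n.
have ss : {subset s <= echelons}.
  by move=> p /flattenP[o]; rewrite mem_filter => /andP[_ /se]; apply.
rewrite (Gorbit_DSS se) (bigcup_DSS se) (isGorbit_DS ss) (card_DS us ss) !card_DSS //.
- by move=> o; rewrite mem_filter => /andP[_ /se].
- by rewrite pairwise_filter.
Qed.

Lemma EnG_merge p q (o1 := lookup orbitsS p) (o2 := lookup orbitsS q) :
  p \in EnG_list -> q \in EnG_list -> size o1 = 20%N -> size o2 = 20%N -> ~~ same o1 o2 ->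
  lookup orbitsG p =i o1 ++ o2 ->
  [/\ D p \in EnG f, D q \in EnG f, #|orbS (D p)| = 20%N /\ #|orbS (D q)| = 20%N,
      orbS (D p) != orbS (D q) & orbG (D p) = orbS (D p) :|: orbS (D q)].
Proof.
move=> p1 p2 z1 z2 d e.
have e1 := sub_EnG_list p1; have e2 := sub_EnG_list p2.
have [_ G1] := orbG_lookup e1; have [oS1 S1] := orbS_lookup e1.
have [oS2 S2] := orbS_lookup e2.
split.
- rewrite EnGE; apply/DSP; exists p; [exact: p1 | exact: erefl].
- rewrite EnGE; apply/DSP; exists q; [exact: p2 | exact: erefl].
- by split; rewrite card_orbS.
- rewrite S1 S2; apply: contra d => /eqP h; apply/sameP.
  by apply: DS_inj h; [exact: sub_orbitsS oS1 | exact: sub_orbitsS oS2].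
- by rewrite G1 S1 S2 -DS_cat; exact: eq_DS e.
Qed.

(** In characteristic 2 the equation x_0 = x x_3 is orthogonality to (1, 0, 0, x); [c] is the unit
    vector of the coordinate that vanishes. *)
Definition xi_line (c : vec) (x : gf4) : gens := zeros c (g1, g0, g0, x).

Lemma xi_lineE (i : nat) (c : vec) x : (i < 4)%N ->
  (forall v, dot v c = co i v) -> zeros_spec c (g1, g0, g0, x) ->
  [set v : 'rV[F]_4 | (xc v i == 0) && (xc v 0 == phi x * xc v 3)] = D (xi_line c x).
Proof.
move=> hi ci /zerosP[_ <-]; apply/setP => v; have [u ->] := vphi_surj v.
rewrite !inE !vphi_dot ci !xc_vphi // phi_eq0; congr andb.
rewrite -phiM -subr_eq0 oppx -phiD phi_eq0; congr (_ == _).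
apply: phi_inj; case: u => [[[a b] c'] d] /=.
by rewrite !(phiD, phiM, phi0, phi1); ring.
Qed.

Definition xi_check (x : gf4) : bool :=
  let p1 := xi_line (g0, g0, g1, g0) x in let p2 := xi_line (g0, g1, g0, g0) x in
  let o1 := lookup orbitsS p1 in let o2 := lookup orbitsS p2 in
  [&& zeros_spec (g0, g0, g1, g0) (g1, g0, g0, x), zeros_spec (g0, g1, g0, g0) (g1, g0, g0, x),
      p1 \in EnG_list, p2 \in EnG_list, size o1 == 20%N, size o2 == 20%N, ~~ same o1 o2 &
      same (lookup orbitsG p1) (o1 ++ o2)].

(** The primitive elements of F are the two elements other than 0 and 1; the check is run for
    both. *)
Lemma xi_checkT x : x != g0 -> x != g1 -> xi_check x.
Proof.
by case: x => [[] []] h0 h1;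
  [vm_compute | case/eqP: h1 | vm_compute | case/eqP: h0].
Qed.

Lemma xi_lines (xi : F) : (#|F|.-1).-primitive_root xi ->
  let l1 := [set v : 'rV[F]_4 | (xc v 2 == 0) && (xc v 0 == xi * xc v 3)] in
  let l2 := [set v : 'rV[F]_4 | (xc v 1 == 0) && (xc v 0 == xi * xc v 3)] in
  [/\ l1 \in EnG f, l2 \in EnG f, #|orbS l1| = 20%N /\ #|orbS l2| = 20%N,
      orbS l1 != orbS l2 & orbG l1 = orbS l1 :|: orbS l2].
Proof.
rewrite cardF /=; have [x ->] := phi_surj xi => hx.
have x0 : x != g0.
  rewrite -phi_eq0; apply/eqP => e; have := prim_expr_order hx.
  by rewrite e expr0n => /esym/eqP; rewrite oner_eq0.
have x1 : x != g1.
  apply/eqP => e; have := prim_order_dvd hx 1; rewrite e phi1 expr1 eqxx.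
  by [].
have /and5P[s1 s2 p1 p2 /and4P[/eqP z1 /eqP z2 d /sameP e]] := xi_checkT x0 x1.
have d2 v : dot v (g0, g0, g1, g0) = co 2 v.
  by apply: phi_inj; case: v => [[[a b] c] d'] /=; rewrite !(phiD, phiM, phi0, phi1); ring.
have d1 v : dot v (g0, g1, g0, g0) = co 1 v.
  by apply: phi_inj; case: v => [[[a b] c] d'] /=; rewrite !(phiD, phiM, phi0, phi1); ring.
rewrite (xi_lineE (isT : (2 < 4)%N) d2 s1) (xi_lineE (isT : (1 < 4)%N) d1 s2).
exact: (EnG_merge p1 p2 z1 z2 d e).
Qed.

End Extension.
End Coordinates.

(** X^4 - X = X (X - 1)(X^2 + X + 1) vanishes on all of F, so an element other than 0 and 1 is a
    root of the last factor. *)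
Lemma omega_ex (F : finFieldType) : #|F| = 4%N -> exists th : F, th ^+ 2 = th + 1.
Proof.
move=> cardF.
have [th h] : exists th : F, th \notin [set 0; 1].
  apply/existsP; rewrite -negb_forall; apply/negP => /forallP h.
  have : (#|F| <= #|[set 0%R; 1%R : F]|)%N by apply/subset_leq_card/subsetP => x _; apply: h.
  by rewrite cardF cards2; case: (_ != _).
exists th; have := expf_card th; rewrite cardF => h4.
move: h; rewrite !inE negb_or => /andP[h0 h1].
have : (th ^+ 2 + th + 1) * (th * (th - 1)) == 0.
  have -> : (th ^+ 2 + th + 1) * (th * (th - 1)) = th ^+ 4 - th by ring.
  by rewrite h4 subrr.
rewrite !mulf_eq0 subr_eq0 (negPf h0) (negPf h1) !orbF -addrA addr_eq0 => /eqP ->.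
by rewrite oppx.
Qed.

Unset Implicit Arguments.

Theorem theorem6p3 (F K : finFieldType) (f : {rmorphism F -> K}) :
  #|F| = 4%N -> #|K| = 16%N ->
  [/\ #|[set orbG L | L in lines F]| = 12%N,
      [/\ isGorbit (RC F) /\ #|RC F| = 10%N,
          isGorbit (RA F) /\ #|RA F| = 10%N,
          isGorbit (UnG F) /\ #|UnG F| = 60%N &
          isGorbit (EG F) /\ #|EG F| = 60%N],
      [/\ (exists2 L, L \in UG F & #|orbS L| = 15%N),
          (forall L, L \in UG F -> #|orbS L| = 15%N -> orbG L = orbS L),
          (exists2 L, L \in UG F & #|orbS L| = 5%N) &
          (forall L, L \in UG F -> #|orbS L| = 5%N ->
             orbG L = Tr F :|: orbS L /\ #|Tr F :|: orbS L| = 10%N)],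
      isGorbit (IC f :|: IA f) /\ #|IC f :|: IA f| = 12%N &
      [/\ (let S20 := [set orbS L | L in [set L in EnG f | #|orbS L| == 20%N]] in
           [/\ #|S20| = 3%N, #|[set O in S20 | isGorbit O]| = 1%N,
               isGorbit (\bigcup_(O in S20 | ~~ isGorbit O) O) &
               #|\bigcup_(O in S20 | ~~ isGorbit O) O| = 40%N]),
          (let S30 := [set orbS L | L in [set L in EnG f | #|orbS L| == 30%N]] in
           [/\ #|S30| = 4%N, #|[set O in S30 | isGorbit O]| = 2%N,
               isGorbit (\bigcup_(O in S30 | ~~ isGorbit O) O) &
               #|\bigcup_(O in S30 | ~~ isGorbit O) O| = 60%N]) &
          (forall xi : F, (#|F|.-1).-primitive_root xi ->
           let l1 := [set v : 'rV[F]_4 | (xc v 2 == 0) && (xc v 0 == xi * xc v 3)] in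
           let l2 := [set v : 'rV[F]_4 | (xc v 1 == 0) && (xc v 0 == xi * xc v 3)] in
           [/\ l1 \in EnG f, l2 \in EnG f,
               #|orbS l1| = 20%N /\ #|orbS l2| = 20%N,
               orbS l1 != orbS l2 &
               orbG l1 = orbS l1 :|: orbS l2])]].
Proof.
(* The goal does not mention [th], so either root of X^2 = X + 1 serves. *)
move=> cardF cardK; have [th thE] := omega_ex cardF.
split; [exact: (card_Gorbits cardF thE)| split | split | | split].
- exact: (RC_Gorbit cardF thE).
- exact: (RA_Gorbit cardF thE).
- exact: (UnG_Gorbit cardF thE).
- exact: (EG_Gorbit cardF thE).
- exact: (UG_ex cardF thE UG_list_ex15).
- exact: (UG15 cardF thE).
- exact: (UG_ex cardF thE UG_list_ex5).
- exact: (UG5 cardF thE).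
- exact: (imaginary_Gorbit cardF thE f cardK).
- by apply: (EnG_orbits cardF thE f cardK); vm_compute.
- by apply: (EnG_orbits cardF thE f cardK); vm_compute.
- move=> xi hx; exact: (xi_lines cardF thE f cardK hx).
Qed.
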